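(* Let $\mathbb{K}$ be a valued field with divisible value group $G$, infinite residue field, and valuation topology having a countable basis of neighbourhoods of $0$. Let $\mathbb{L}\supseteq\mathbb{K}$ be a complete henselian valued extension with the same value group $G$, and whose topology also has a countable basis of neighbourhoods of $0$. Let $\overline{\mathbb{L}}$ be an algebraic closure of $\mathbb{L}$ with the extended valuation, and let $S(X)\in\mathbb{L}[[X]]$. Then: (a) Let $\alpha\in G$. If $S$ converges on $C_{\alpha,\mathbb{K}}$ and there exist $a,b\in C_{\alpha,\mathbb{K}}$ such that $v(S(a))\neq v(S(b))$, then there exists $c\in\overline{\mathbb{L}}$ such that $v(c)=\alpha$ and $S(c)=0$. Moreover, for every $\gamma\in G$ lying between $v(S(a))$ and $v(S(b))$ there is an element $c'\in C_{\alpha,\mathbb{K}}$ such that $v(S(c'))=\gamma$. (b) Suppose that $S$ is not the zero series and define $$H_S=\{\alpha\in G\mid \exists x\in\overline{\mathbb{L}}\text{ such that } S(x)=0,\ v(x)=\alpha\}.$$ For every $\alpha\in H_S$ the set $\{x\in Z_{S,\overline{\mathbb{L}}}\mid v(x)\ge\alpha\}$ is finite. As a consequence the set $\{\beta\in H_S\mid\beta>\alpha\}$ is finite. (c) The assignment $\phi_{S,\mathbb{K}}: v(x)\mapsto v(S(x))$ ($x\in D_{S,\mathbb{K}}$) is a (well-defined) stepwise linear and non-decreasing function on the set $V=(v(D_{S,\mathbb{K}})\cap G)\setminus H_S$. (d) Let $\alpha\in v(D_{S,\mathbb{K}})\cap G$. Then the set $\{v(S(x))\mid x\in C_{\alpha,\mathbb{K}}\}$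 is a left-bounded and left-closed interval in $G\cup\{\infty\}$. (e) The map $\phi_{S,\mathbb{K}}$ can be extended to a continuous function on the whole of $v(D_{S,\mathbb{K}})\cap G$ by choosing, for $\alpha\in v(D_{S,\mathbb{K}})\cap G$, $$\phi_{S,\mathbb{K}}(\alpha)=\min\{v(S(x))\mid x\in C_{\alpha,\mathbb{K}}\}.$$
   Context: A valued field is a field with a non-trivial (Krull) valuation, i.e. a surjective map $v$ onto $G\cup\{\infty\}$, with $G$ a totally ordered abelian group (of arbitrary rank) written additively, $v(x)=\infty$ iff $x=0$. The valuation topology has the sets $\{x: v(x)>\gamma\}$, $\gamma\in G$, as a basis of neighbourhoods of $0$. The same symbol $v$ denotes the valuations of $\mathbb{K}$, $\mathbb{L}$ and $\overline{\mathbb{L}}$; since $\mathbb{L}$ is henselian and $G$ divisible, the extension to $\overline{\mathbb{L}}$ is unique and has value group $G$. Notation: $C_{\alpha,\mathbb{K}}=\{x\in\mathbb{K}\mid v(x)=\alpha\}$; $D_{S,\mathbb{K}}=\{x\in\mathbb{K}\mid S(X)\text{ converges at }x\}$ (convergence in $\mathbb{L}$); $D_{S,\overline{\mathbb{L}}}=\{x\in\overline{\mathbb{L}}\mid S(X)\text{ converges at }x\}$ (convergence in $\overline{\mathbb{L}}$); $Z_{S,\overline{\mathbb{L}}}=\{x\in D_{S,\overline{\mathbb{L}}}\mid S(x)=0\}$. The set $H_S$ defined in (b) is also used in (c). An equation $S(x)=0$ includes the requirement that $S$ converges at $x$. ''Stepwise linear'' on $V$ means: on every convex subset of $v(D_{S,\mathbb{K}})\cap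 G$ disjoint from $H_S$, the function has the form $g\mapsto A+Bg$ with $A\in G$ and $B$ a non-negative integer. A ''left-bounded and left-closed interval'' is a non-empty convex subset having a least element. Continuity refers to the order topologies. *)

(* Defs.v *)
From HB Require Import structures.
From mathcomp Require Import all_boot all_order all_algebra.
From mathcomp Require Import all_classical all_reals all_analysis.

Set Implicit Arguments.
Unset Strict Implicit.
Unset Printing Implicit Defensive.

Import Order.TTheory GRing.Theory Num.Theory.

Local Open Scope classical_set_scope.
Local Open Scope ring_scope.

(* An HB structure joining zmodType and orderType cannot be declared once
   Num.RealDomain exists (the joins would be ambiguous), whence this record; its
   carrier gets the instances porderZmodType and orderType. *)
Record oagType := OagType {
  oag_zmod : zmodType;
  oag_rel : rel oag_zmod;
  oag_refl : reflexive oag_rel;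
  oag_anti : antisymmetric oag_rel;
  oag_trans : transitive oag_rel;
  oag_total : total oag_rel;
  oag_relD2l : forall x y z, oag_rel x y -> oag_rel (z + x) (z + y)
}.

Definition oag_car (G : oagType) : Type := oag_zmod G.
Coercion oag_car : oagType >-> Sortclass.

Section OagInstances.
Variable G : oagType.

HB.instance Definition _ := GRing.Zmodule.on (oag_car G).
HB.instance Definition _ := Order.Le_isPOrder.Build ring_display (oag_car G)
  (@oag_refl G) (@oag_anti G) (@oag_trans G).
HB.instance Definition _ :=
  Order.POrder_isTotal.Build ring_display (oag_car G) (@oag_total G).

Lemma oag_leD2l (x y z : G) : x <= y -> z + x <= z + y.
Proof. exact: oag_relD2l. Qed.

End OagInstances.

Definition divisible_group (G : zmodType) : Prop :=
  forall (n : nat) (g : G), (0 < n)%N -> exists h : G, h *+ n = g.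

Variant extval (G : Type) : Type := Fin of G | Infty.
Arguments Infty {G}.

Section ExtvalOrder.
Variable G : oagType.

Definition extval_opt (x : extval G) : option G :=
  if x is Fin g then Some g else None.
Definition opt_extval (x : option G) : extval G :=
  if x is Some g then Fin g else Infty.
Lemma extval_optK : cancel extval_opt opt_extval.
Proof. by case. Qed.

HB.instance Definition _ := Choice.copy (extval G) (can_type extval_optK).

Definition extval_le (x y : extval G) : bool :=
  match x, y with
  | _, Infty => true
  | Infty, Fin _ => false
  | Fin g, Fin h => g <= h
  end.

Fact extval_le_refl : reflexive extval_le.
Proof. by case=> //= g; exact: lexx. Qed.

Fact extval_le_anti : antisymmetric extval_le.
Proof. by move=> [g|] [h|] //= /le_anti ->. Qed.

Fact extval_le_trans : transitive extval_le.
Proof. by move=> [g|] [h|] [k|] //=; exact: le_trans. Qed.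

HB.instance Definition _ := Order.Le_isPOrder.Build ring_display (extval G)
  extval_le_refl extval_le_anti extval_le_trans.

Fact extval_le_total : total (<=%O : rel (extval G)).
Proof. by move=> [g|] [h|] //=; exact: (le_total g h). Qed.

HB.instance Definition _ :=
  Order.POrder_isTotal.Build ring_display (extval G) extval_le_total.

Definition extval_add (x y : extval G) : extval G :=
  match x, y with
  | Fin g, Fin h => Fin (g + h)
  | _, _ => Infty
  end.

Lemma extval_leE (g h : G) : (Fin g <= Fin h) = (g <= h).
Proof. by []. Qed.

Lemma extval_ltE (g h : G) : (Fin g < Fin h) = (g < h).
Proof. by rewrite !ltNge. Qed.

Lemma extval_lt_Infty (g : G) : Fin g < Infty.
Proof. by rewrite ltNge. Qed.

End ExtvalOrder.

(* The trivial group G is not excluded here: non-triviality of the valuation,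
   i.e. of G, is a separate hypothesis. *)
Record valuation (K : fieldType) (G : oagType) := Valuation {
  valn :> K -> extval G;
  valn_onto : forall g : G, exists x : K, valn x = Fin g;
  valn_eqInfty : forall x : K, valn x = Infty <-> x = 0;
  valnM : forall x y : K, valn (x * y) = extval_add (valn x) (valn y);
  valnD : forall x y : K, Order.min (valn x) (valn y) <= valn (x + y)
}.

Section ValuationBasics.
Variables (K : fieldType) (G : oagType) (v : valuation K G).

Lemma valn0 : v 0 = Infty.
Proof. exact/valn_eqInfty. Qed.

Lemma oag_double0 (g : G) : g + g = 0 -> g = 0.
Proof.
move=> gg0; have [g0|g0] := leP (0 : G) g.
  apply/eqP; rewrite eq_le g0 andbT.
  by have := oag_leD2l g g0; rewrite addr0 gg0.
apply/eqP; rewrite eq_le (ltW g0) /=.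
by have := oag_leD2l g (ltW g0); rewrite addr0 gg0.
Qed.

Lemma valn1 : v 1 = Fin 0.
Proof.
have := valnM v 1 1; rewrite mulr1.
case E : (v 1) => [g|]; last by move/valn_eqInfty/eqP: E; rewrite oner_eq0.
by case=> e; congr Fin; apply: (addrI g); rewrite -e addr0.
Qed.

Lemma valnN (x : K) : v (- x) = v x.
Proof.
have vN1 : v (-1) = Fin 0.
  have := valnM v (-1) (-1); rewrite mulrNN mulr1 valn1.
  by case: (v (-1)) => [g|] //= [] /esym/oag_double0 ->.
by rewrite -mulN1r valnM vN1; case: (v x) => //= g; rewrite add0r.
Qed.

Lemma valn_gtD (x y : K) (g : extval G) :
  g < v x -> g < v y -> g < v (x + y).
Proof.
by move=> gx gy; apply: lt_le_trans (valnD v x y); rewrite lt_min gx gy.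
Qed.

End ValuationBasics.

(* A copy of the field K, carrying the uniformity (hence the topology) of v. *)
Definition valued (K : fieldType) (G : oagType) (v : valuation K G) : Type := K.

Section ValuationTopology.
Variables (K : fieldType) (G : oagType) (v : valuation K G).

HB.instance Definition _ := GRing.Field.on (valued v).
HB.instance Definition _ := isPointed.Build (valued v) (0 : K).

Definition valued_ent : set_system (valued v * valued v) :=
  filter_from [set: G] (fun g => [set p | Fin g < v (p.1 - p.2)]).

Fact valued_ent_filter : Filter valued_ent.
Proof.
apply: filter_from_filter; first by exists 0.
move=> g h _ _; exists (Order.max g h) => // p /=.
have [gh|hg] := leP g h => pP.
  by split=> //; apply: le_lt_trans pP; rewrite extval_leE.
by split=> //; apply: le_lt_trans pP; rewrite extval_leE ltW.
Qed.

Fact valued_ent_diag A : valued_ent A -> (diagonal `<=` A)%relation.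
Proof.
move=> [g _ gA] p pp; apply: gA => /=.
by rewrite (_ : p.1 = p.2) // subrr valn0 extval_lt_Infty.
Qed.

Fact valued_ent_inv A : valued_ent A -> valued_ent (A^-1)%relation.
Proof.
move=> [g _ gA]; exists g => // -[x y] /= xy; apply: gA => /=.
by rewrite -valnN opprB.
Qed.

Fact valued_ent_split A : valued_ent A ->
  exists2 B, valued_ent B & (B \; B `<=` A)%relation.
Proof.
move=> [g _ gA]; exists [set p | Fin g < v (p.1 - p.2)]; first by exists g.
move=> [x z] [y /= xy yz]; apply: gA => /=.
have -> : (x : K) - z = (x - y) + (y - z) by rewrite addrA subrK.
exact: valn_gtD.
Qed.

HB.instance Definition _ := isUniform.Build (valued v)
  valued_ent_filter valued_ent_diag valued_ent_inv valued_ent_split.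

Lemma nbhs_valuedE (x : valued v) :
  nbhs x = filter_from [set: G] (fun g => [set y : valued v | Fin g < v (y - x)]).
Proof.
rewrite eqEsubset; split=> U.
  rewrite -nbhs_entourageE => -[E [g _ gE] EU]; exists g => // y yx.
  by apply: EU; rewrite /xsection /= inE; apply: gE; rewrite /= -valnN opprB.
move=> [g _ gU]; rewrite -nbhs_entourageE.
exists [set p : valued v * valued v | Fin g < v (p.1 - p.2)]; first by exists g.
by move=> y; rewrite /xsection /= inE /= => yx; apply: gU; rewrite /= -valnN opprB.
Qed.

Definition countable_nbhs_basis0 : Prop :=
  exists2 B : set (set (valued v)), countable B &
    B `<=` nbhs (0 : valued v) /\
    forall U, nbhs (0 : valued v) U -> exists2 A, B A & A `<=` U.

Definition complete_valued : Prop :=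
  forall F : set_system (valued v), ProperFilter F -> cauchy F -> cvg F.

End ValuationTopology.

Section Residue.
Variables (K : fieldType) (G : oagType) (v : valuation K G).

(* The underlying set of O/m: the cosets a + m, for a in the valuation ring O,
   of the maximal ideal m. *)
Definition residue_field : set (set K) :=
  [set A | exists2 a, Fin 0 <= v a & A = [set x | Fin 0 < v (x - a)]].

Definition integral_poly (p : {poly K}) : Prop :=
  forall i, Fin 0 <= v p`_i.

Definition same_reduction (p q : {poly K}) : Prop :=
  forall i, Fin 0 < v (p - q)`_i.

(* The valuation ring O is a henselian local ring: every factorization of the
   reduction mod m of a monic f in O[X] into two coprime monic polynomials
   lifts to a factorization of f into monic polynomials of O[X].  The two
   factors over the residue field are given by monic lifts g, h, and their
   coprimality by a Bezout relation mod m. *)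
Definition henselian : Prop :=
  forall f g h : {poly K},
    integral_poly f -> integral_poly g -> integral_poly h ->
    f \is monic -> g \is monic -> h \is monic ->
    same_reduction f (g * h) ->
    (exists a b : {poly K},
      [/\ integral_poly a, integral_poly b &
          same_reduction (a * g + b * h) 1]) ->
    exists g' h' : {poly K},
      [/\ integral_poly g' /\ integral_poly h',
          g' \is monic /\ h' \is monic,
          f = g' * h' &
          same_reduction g' g /\ same_reduction h' h].

End Residue.

Section PowerSeries.
Variables (K : fieldType) (G : oagType) (v : valuation K G).

(* The power series sum_k c_k X^k is given by its coefficients c. *)
Definition ps_sums (c : nat -> K) (x : K) : nat -> valued v :=
  series (fun k => c k * x ^+ k : valued v).

Definition ps_cvg (c : nat -> K) (x : K) : Prop := cvgn (ps_sums c x).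

Definition ps_eval (c : nat -> K) (x : K) : K := limn (ps_sums c x).

Definition ps_zeros (c : nat -> K) : set K :=
  [set x | ps_cvg c x /\ ps_eval c x = 0].

End PowerSeries.

Section Ordered.
Variables (d : Order.disp_t) (T : orderType d).

Definition convex_in (A : set T) : Prop :=
  forall x y z, A x -> A y -> (x <= z <= y)%O -> A z.

Definition is_least (A : set T) (m : T) : Prop := A m /\ lbound A m.

Definition left_closed_interval (A : set T) : Prop :=
  [/\ A !=set0, convex_in A & exists m, is_least A m].

End Ordered.

Section Attached.
Variables (G : oagType) (K L : fieldType) (Lbar : fieldType).
Variables (vK : valuation K G) (vL : valuation L G) (vLbar : valuation Lbar G).
Variables (iota : K -> L) (j : L -> Lbar) (S : nat -> L).

Definition sphere (alpha : G) : set K := [set x | vK x = Fin alpha].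

Definition conv_dom : set K := [set x | ps_cvg vL S (iota x)].

Definition valS (x : K) : extval G := vL (ps_eval vL S (iota x)).

Definition zero_set : set Lbar := ps_zeros vLbar (j \o S).

Definition zero_values : set G :=
  [set alpha | exists2 x, zero_set x & vLbar x = Fin alpha].

Definition conv_values : set G :=
  [set alpha | exists2 x, conv_dom x & vK x = Fin alpha].

(* phi realizes v(x) |-> v(S(x)) on V = (v(D_{S,K}) n G) \ H_S; the existence of
   such a phi says that this assignment is well defined. *)
Definition is_phi (phi : G -> extval G) : Prop :=
  forall (alpha : G) (x : K), (conv_values `\` zero_values) alpha ->
    conv_dom x -> vK x = Fin alpha -> phi alpha = valS x.

Definition stepwise_linear (phi : G -> extval G) : Prop :=
  forall C : set G,
    convex_in C -> C `<=` conv_values -> C `&` zero_values = set0 ->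
    exists (A : G) (B : nat), forall g, C g -> phi g = Fin (A + g *+ B).

End Attached.

(* Main.v *)
Require Import Defs.
From HB Require Import structures.
From mathcomp Require Import all_boot all_order all_algebra.
From mathcomp Require Import all_classical all_reals all_analysis.
From mathcomp Require Import ring zify.

Set Implicit Arguments.
Unset Strict Implicit.
Unset Printing Implicit Defensive.

Import Order.TTheory GRing.Theory Num.Theory.

Local Open Scope classical_set_scope.
Local Open Scope ring_scope.

(** A truncation of [S], rescaled to the ball [v(x) >= alpha], reduces to a polynomial
    of degree [n], the last index at which [v(S_k) + k alpha] is minimal.  In rank
    greater than one the contraction behind Weierstrass division need not converge, so
    henselianity is used to split each truncation into a monic factor of degree [n] and
    a factor of constant valuation on the ball; the monic factors of successive
    truncations form a Cauchy sequence, whose limit [P] satisfies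
    [v(S(x)) = nu + sum_c v(x - c)] on the ball, [c] ranging over the roots of [P],
    which are exactly the zeros of [S] there.

    The residue field being infinite, around any [y] in [K] there are points [x] with
    [v(x - y) = l] and [v(x - c) = min(l, v(y - c))] for all these [c] at once, so that
    the value distribution of [S] on a sphere is read off the piecewise linear maps
    [l |-> nu + sum_c min(l, v(y - c))]. *)

(** * Ordered groups and valuations *)

(** Henselianity, as given, lifts only factorizations of monic polynomials, while a truncation may
    have degree above [n] with small top coefficients. Reversal makes it monic up to a unit once its
    constant coefficient is a unit; a translation to a point where the reduction does not vanish
    arranges this, and the infinite residue field of [K] supplies such a point.

    [Lbar] need not be complete, so [S] is not known to converge at a given point of [Lbar]. The
    argument therefore only compares valuations of partial sums with those of elements tending to a
    product over roots: the sums tend to [0] exactly when the product vanishes, which settles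
    convergence and vanishing together.

    Divisibility of [G] enters twice: to hit a prescribed value on a sphere, and to divide the
    radius in the continuity proof. The zero series, whose zero values fill [G], is treated
    apart. *)

Section OrderedGroup.
Variable G : oagType.
Implicit Types (x y z t : G) (n : nat).

Lemma oag_leD2lE z x y : (z + x <= z + y) = (x <= y).
Proof.
apply/idP/idP; last exact: oag_leD2l.
by move/(oag_leD2l (- z)); rewrite !addKr.
Qed.

Lemma oag_ltD2lE z x y : (z + x < z + y) = (x < y).
Proof. by rewrite !ltNge oag_leD2lE. Qed.

Lemma oag_leD2rE z x y : (x + z <= y + z) = (x <= y).
Proof. by rewrite -!(addrC z) oag_leD2lE. Qed.

Lemma oag_ltD2rE z x y : (x + z < y + z) = (x < y).
Proof. by rewrite -!(addrC z) oag_ltD2lE. Qed.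

Lemma oag_leD x y z t : x <= y -> z <= t -> x + z <= y + t.
Proof.
by move=> xy zt; apply: (@le_trans _ _ (y + z)); rewrite ?oag_leD2rE ?oag_leD2lE.
Qed.

Lemma oag_ltD x y z t : x < y -> z <= t -> x + z < y + t.
Proof.
by move=> xy zt; apply: (@lt_le_trans _ _ (y + z)); rewrite ?oag_ltD2rE ?oag_leD2lE.
Qed.

Lemma oag_subr_ge0 x y : (0 <= y - x) = (x <= y).
Proof. by rewrite -(oag_leD2rE x 0) add0r subrK. Qed.

Lemma oag_subr_gt0 x y : (0 < y - x) = (x < y).
Proof. by rewrite -(oag_ltD2rE x 0) add0r subrK. Qed.

Lemma oag_leMn n x y : x <= y -> x *+ n <= y *+ n.
Proof. by move=> xy; elim: n => // n IH; rewrite !mulrS oag_leD. Qed.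

Lemma oag_ltMn n x y : x < y -> x *+ n.+1 < y *+ n.+1.
Proof. by move=> xy; rewrite !mulrS oag_ltD // oag_leMn // ltW. Qed.

Lemma oag_leMnE n x y : (0 < n)%N -> (x *+ n <= y *+ n) = (x <= y).
Proof.
case: n => // n _; apply/idP/idP; last exact: oag_leMn.
by apply: contraTT; rewrite -!ltNge; exact: oag_ltMn.
Qed.

Lemma oag_mulrn_inj n m x : 0 < x -> x *+ n = x *+ m -> n = m.
Proof.
move=> x0; elim: n m => [|n IH] [|m] //=.
- by rewrite mulr0n => e; have := oag_ltMn m x0; rewrite mul0rn -e ltxx.
- by rewrite mulr0n => e; have := oag_ltMn n x0; rewrite mul0rn e ltxx.
- by rewrite !mulrS => /addrI /IH ->.
Qed.

Lemma oag_le_sum (I : Type) (s : seq I) (E F : I -> G) :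
  (forall i, E i <= F i) -> \sum_(i <- s) E i <= \sum_(i <- s) F i.
Proof.
by move=> EF; elim: s => [|i s IH]; rewrite ?big_nil ?big_cons // oag_leD.
Qed.

End OrderedGroup.

Section Extended.
Variable G : oagType.
Implicit Types (x y z t : extval G) (g h : G).

Lemma extval_addA : associative (@extval_add G).
Proof. by case=> [g|] [h|] [k|] //=; rewrite addrA. Qed.

Lemma extval_addC : commutative (@extval_add G).
Proof. by case=> [g|] [h|] //=; rewrite addrC. Qed.

Lemma extval_add0 : left_id (Fin 0) (@extval_add G).
Proof. by case=> [g|] //=; rewrite add0r. Qed.

HB.instance Definition _ := Monoid.isComLaw.Build (extval G) (Fin 0)
  (@extval_add G) extval_addA extval_addC extval_add0.

Lemma extval_leInfty x : x <= Infty.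
Proof. by case: x. Qed.

Lemma extval_leD x y z t : x <= y -> z <= t -> extval_add x z <= extval_add y t.
Proof.
by case: x y z t => [x|] [y|] [z|] [t|] //; rewrite !extval_leE; exact: oag_leD.
Qed.

Lemma extval_ltD g y z t : Fin g < y -> z <= t ->
  z != Infty -> extval_add (Fin g) z < extval_add y t.
Proof.
case: y z t => [y|] [z|] [t|] //=; rewrite ?extval_lt_Infty //.
by rewrite !extval_ltE !extval_leE => gy zt _; exact: oag_ltD.
Qed.

Lemma extval_ltD2l g x y : (extval_add (Fin g) x < extval_add (Fin g) y) = (x < y).
Proof.
by case: x y => [x|] [y|] //=; rewrite ?extval_lt_Infty ?ltxx // !extval_ltE oag_ltD2lE.
Qed.

Lemma extval_leD2l g x y : (extval_add (Fin g) x <= extval_add (Fin g) y) = (x <= y).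
Proof. by rewrite !leNgt extval_ltD2l. Qed.

Lemma extval_lt_fin x y : x < y -> exists g, x = Fin g.
Proof. by case: x => [g|]; [exists g | case: y]. Qed.

End Extended.

Section Valuation.
Variables (K : fieldType) (G : oagType) (v : valuation K G).
Implicit Types (x y : K) (g : G).

Lemma valn_neq0 x : x != 0 -> exists g, v x = Fin g.
Proof.
move=> x0; case E: (v x) => [g|]; first by exists g.
by move/valn_eqInfty/eqP: E; rewrite (negPf x0).
Qed.

Lemma valn_fin_neq0 x g : v x = Fin g -> x != 0.
Proof. by move=> xg; apply/eqP => x0; move: xg; rewrite x0 valn0. Qed.

Lemma valn_sub x y : v (x - y) = v (y - x).
Proof. by rewrite -valnN opprB. Qed.

Lemma valnD_lt x y : v y < v x -> v (x + y) = v y.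
Proof.
move=> yx; apply/eqP; rewrite eq_le; apply/andP; split; last first.
  by apply: le_trans (valnD v x y); rewrite le_min lexx ltW.
have := valnD v (x + y) (- x); rewrite [x + y - x]addrC addKr valnN ge_min => /orP[//|xy].
by have := lt_le_trans yx xy; rewrite ltxx.
Qed.

Lemma valnX x g n : v x = Fin g -> v (x ^+ n) = Fin (g *+ n).
Proof.
move=> xg; elim: n => [|n IH]; first by rewrite expr0 valn1.
by rewrite exprS valnM IH xg /= mulrS.
Qed.

Lemma valnV x g : v x = Fin g -> v x^-1 = Fin (- g).
Proof.
move=> xg; have x0 := valn_fin_neq0 xg.
have := valnM v x x^-1; rewrite divff // valn1 xg; case: (v _) => //= h [] e.
by congr Fin; rewrite -(addKr g h) -e addr0.
Qed.

Lemma valn_prod (I : Type) (s : seq I) (F : I -> K) :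
  v (\prod_(i <- s) F i) = \big[@extval_add G/Fin 0]_(i <- s) v (F i).
Proof.
by elim: s => [|i s IH]; rewrite ?big_nil ?big_cons ?valn1 // valnM IH.
Qed.

(** Submodules over the valuation ring. Integrality, smallness of the reduction and closeness up to
    [g] are all of this form, so one set of polynomial lemmas serves the three. *)
Definition valn_ideal (I : K -> Prop) :=
  [/\ I 0, forall x y, I x -> I y -> I (x + y) &
      forall a x, Fin 0 <= v a -> I x -> I (a * x)].

Lemma valn_ideal_ge (e : extval G) : valn_ideal (fun x => e <= v x).
Proof.
split=> [|x y ex ey|a x a0 ex]; first by rewrite valn0 extval_leInfty.
  by apply: le_trans (valnD v x y); rewrite le_min ex ey.
by rewrite valnM -(extval_add0 e); exact: extval_leD.
Qed.

Lemma valn_ideal_gt g : valn_ideal (fun x => Fin g < v x).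
Proof.
split=> [|x y|a x a0 gx]; first by rewrite valn0 extval_lt_Infty.
  exact: valn_gtD.
rewrite valnM extval_addC -[Fin g](extval_add0) extval_addC.
by apply: extval_ltD.
Qed.

Section Ideal.
Variable I : K -> Prop.
Hypothesis II : valn_ideal I.

Lemma valn_idealN x : I x -> I (- x).
Proof. by case: II => _ _ M Ix; rewrite -mulN1r; apply: M; rewrite ?valnN ?valn1. Qed.

Lemma valn_idealB x y : I x -> I y -> I (x - y).
Proof. by move=> Ix Iy; case: (II) => _ D _; apply: D => //; exact: valn_idealN. Qed.

Lemma valn_ideal_sum (J : Type) (s : seq J) (P : pred J) (F : J -> K) :
  (forall i, P i -> I (F i)) -> I (\sum_(i <- s | P i) F i).
Proof. by case: II => I0 ID _ IF; exact: big_ind. Qed.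

Definition poly_in (p : {poly K}) := forall i, I p`_i.

Lemma poly_inD p q : poly_in p -> poly_in q -> poly_in (p + q).
Proof. by move=> Ip Iq i; rewrite coefD; case: II => _ D _; exact: D. Qed.

Lemma poly_inB p q : poly_in p -> poly_in q -> poly_in (p - q).
Proof. by move=> Ip Iq i; rewrite coefB; exact: valn_idealB. Qed.

Lemma poly_inM p q : Defs.integral_poly v p -> poly_in q -> poly_in (p * q).
Proof.
move=> Ip Iq i; rewrite coefM; apply: valn_ideal_sum => k _.
by case: II => _ _ M; exact: M.
Qed.

Lemma poly_inC c : I c -> poly_in c%:P.
Proof. by move=> Ic i; rewrite coefC; case: eqP => // _; case: II. Qed.

Lemma poly_in_horner p x : poly_in p -> Fin 0 <= v x -> I p.[x].
Proof.
case: (II) => I0 ID IM Ip x0; rewrite horner_coef.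
apply: valn_ideal_sum => k _; rewrite mulrC; apply: IM => //.
elim: (nat_of_ord k) => [|n IH]; first by rewrite expr0 valn1.
by rewrite exprS valnM -(extval_add0 (Fin 0)); apply: extval_leD.
Qed.

(** Since [p] is monic and [r] is shorter, the leading coefficient of [q] is the top coefficient of
    [q * p + r], hence in [I]; subtracting the leading term of [q] times [p] allows induction on the
    size of [q]. *)
Lemma poly_in_monic_div (p q r : {poly K}) : Defs.integral_poly v p -> p \is monic ->
  (size r < size p)%N -> poly_in (q * p + r) -> poly_in q /\ poly_in r.
Proof.
move=> intp mp; have [n] := ubnP (size q).
elim: n q r => // n IH q r sq sr Iqr.
have [q0|q0] := eqVneq q 0.
  move: Iqr; rewrite q0 mul0r add0r; split=> // i.
  by rewrite coef0; case: II.
have Ilq : I (lead_coef q).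
  have <- : (q * p + r)`_(size q + size p).-2 = lead_coef q.
    have szM : size (q * p) = (size q + size p).-1 by rewrite size_Mmonic.
    have szq : (0 < size q)%N by rewrite size_poly_gt0.
    have szp : (0 < size p)%N by rewrite size_poly_gt0 monic_neq0.
    rewrite coefD [r`_ _]nth_default ?addr0; last first.
      by move: sr szq szp; case: (size p) (size q) => [|a] [|b] //=; lia.
    by rewrite -[RHS](lead_coef_Mmonic q mp) lead_coefE szM.
  exact: Iqr.
set m := lead_coef q *: 'X^((size q).-1) : {poly K}.
have Im : poly_in m.
  move=> i; rewrite coefZ coefXn; case: II => I0 _ IM.
  by case: eqP; rewrite ?mulr1 ?mulr0.
have qE : q = (q - m) + m by rewrite subrK.
have [] := IH (q - m) r.
- apply: (@leq_trans (size q)); last by rewrite -ltnS.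
  have szq : (0 < size q)%N by rewrite size_poly_gt0.
  rewrite -(prednK szq) ltnS; apply/leq_sizeP => i hi.
  rewrite coefB coefZ coefXn; case: eqP => [->|/eqP ne].
    by rewrite mulr1 /lead_coef subrr.
  rewrite mulr0 subr0 nth_default // -(prednK szq) ltn_neqAle hi andbT.
  by rewrite eq_sym.
- by [].
- have -> : (q - m) * p + r = (q * p + r) - p * m by ring.
  by apply: poly_inB => //; exact: poly_inM.
move=> Iqm Ir; split=> //; rewrite qE; exact: poly_inD.
Qed.

End Ideal.

End Valuation.

(** * Factoring a polynomial by henselianity *)

Section PolyReversal.
Variable R : comNzRingType.
Implicit Types (p q : {poly R}) (n k : nat).

(** The reciprocal polynomial for a nominal degree [n]. Coefficients beyond [n] are dropped, which
    lets [poly_rev n] also reverse the part of degree at most [n] of a longer polynomial. *)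
Definition poly_rev n p : {poly R} := \poly_(i < n.+1) p`_(n - i).

Lemma coef_poly_rev n p i :
  (poly_rev n p)`_i = if (i <= n)%N then p`_(n - i) else 0.
Proof. by rewrite coef_poly ltnS. Qed.

Lemma size_poly_rev n p : (size (poly_rev n p) <= n.+1)%N.
Proof. exact: size_poly. Qed.

Lemma poly_revZ n a p : poly_rev n (a *: p) = a *: poly_rev n p.
Proof.
by apply/polyP => i; rewrite coefZ !coef_poly_rev coefZ; case: ifP; rewrite ?mulr0.
Qed.

Lemma poly_revK n p : (size p <= n.+1)%N -> poly_rev n (poly_rev n p) = p.
Proof.
move=> sp; apply/polyP => i; rewrite !coef_poly_rev leq_subr.
by case: leqP => ni; [rewrite subKn | rewrite nth_default // (leq_trans sp)].
Qed.

Lemma poly_rev_sum n (I : Type) (s : seq I) (F : I -> {poly R}) :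
  poly_rev n (\sum_(i <- s) F i) = \sum_(i <- s) poly_rev n (F i).
Proof.
apply: (big_morph (poly_rev n)) => [p q|]; apply/polyP => i.
  by rewrite coefD !coef_poly_rev coefD; case: ifP; rewrite ?addr0.
by rewrite coef_poly_rev !coef0; case: ifP.
Qed.

Lemma poly_revXn n k : (k <= n)%N -> poly_rev n 'X^k = 'X^(n - k).
Proof.
move=> kn; apply/polyP => i; rewrite coef_poly_rev !coefXn.
case: leqP => ni.
  by rewrite (_ : (n - i == k)%N = (i == n - k)%N) //; apply/eqP/eqP; lia.
by rewrite (_ : (i == n - k)%N = false) //; apply/eqP; lia.
Qed.

Lemma poly_wide n p : (size p <= n)%N -> p = \sum_(i < n) p`_i *: 'X^i.
Proof.
move=> sp; rewrite -poly_def; apply/polyP => i; rewrite coef_poly.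
by case: ltnP => // ni; rewrite nth_default // (leq_trans sp).
Qed.

Lemma poly_revE n p : (size p <= n.+1)%N ->
  poly_rev n p = \sum_(i < n.+1) p`_i *: 'X^(n - i).
Proof.
move=> sp; rewrite {1}(poly_wide sp) poly_rev_sum; apply: eq_bigr => i _.
by rewrite poly_revZ poly_revXn // -ltnS.
Qed.

Lemma poly_revM k n p q : (size p <= k.+1)%N -> (size q <= n.+1)%N ->
  poly_rev (k + n) (p * q) = poly_rev k p * poly_rev n q.
Proof.
move=> sp sq; rewrite {1}(poly_wide sp) {1}(poly_wide sq) (poly_revE sp) (poly_revE sq).
rewrite !big_distrlr /= poly_rev_sum; apply: eq_bigr => i _.
rewrite poly_rev_sum; apply: eq_bigr => l _.
have [ik ln] : (i <= k)%N /\ (l <= n)%N by split; rewrite -ltnS.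
rewrite -!scalerAl -!scalerAr -!exprD !poly_revZ poly_revXn ?leq_add //.
by congr (_ *: (_ *: 'X^_)); lia.
Qed.

Lemma monic_coef n p : (size p <= n.+1)%N -> p`_n = 1 ->
  p \is monic /\ size p = n.+1.
Proof.
move=> sp pn; have szp : size p = n.+1.
  apply/eqP; rewrite eqn_leq sp ltnNge; apply/negP => ps.
  by move: pn; rewrite nth_default // => /esym/eqP; rewrite oner_eq0.
by split=> //; rewrite monicE lead_coefE szp /= pn.
Qed.

End PolyReversal.

Section Henselian.
Variables (K : fieldType) (G : oagType) (v : valuation K G).
Implicit Types (p q g h : {poly K}) (x u : K).

Let ideal_int := valn_ideal_ge v (Fin 0).
Let ideal_small := valn_ideal_gt v 0.

Lemma valn_int_unit x : Fin 0 <= v x -> v x <= Fin 0 -> v x = Fin 0.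
Proof. by move=> x0 x1; apply/eqP; rewrite eq_le x0 x1. Qed.

Lemma valnM_unit x y : v x = Fin 0 -> v (x * y) = v y.
Proof. by move=> x0; rewrite valnM x0 extval_add0. Qed.

Lemma valnV_unit x : v x = Fin 0 -> v x^-1 = Fin 0.
Proof. by move/valnV; rewrite oppr0. Qed.

Lemma integral_polyXsubC u : Fin 0 <= v u -> Defs.integral_poly v ('X - u%:P).
Proof.
move=> u0; apply: (poly_inB ideal_int); last exact: (poly_inC ideal_int).
move=> i; rewrite coefX; case: eqP => _; first by rewrite valn1.
by rewrite valn0.
Qed.

Lemma integral_polyM p q : Defs.integral_poly v p -> Defs.integral_poly v q ->
  Defs.integral_poly v (p * q).
Proof. exact: (poly_inM ideal_int). Qed.

Lemma integral_poly1 : Defs.integral_poly v 1.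
Proof. by apply: (poly_inC ideal_int); rewrite valn1. Qed.

Lemma integral_polyXn p n : Defs.integral_poly v p -> Defs.integral_poly v (p ^+ n).
Proof.
move=> ip; elim: n => [|n IH]; first exact: integral_poly1.
by rewrite exprS; exact: integral_polyM.
Qed.

Lemma integral_polyX : Defs.integral_poly v 'X.
Proof. by have := @integral_polyXsubC 0; rewrite subr0 valn0; apply. Qed.

Lemma integral_polyZ a p : Fin 0 <= v a -> Defs.integral_poly v p ->
  Defs.integral_poly v (a *: p).
Proof.
move=> a0 ip; rewrite -mul_polyC; apply: integral_polyM => //.
exact: (poly_inC ideal_int).
Qed.

(* Each element of [us] lies over one root of the reduction of [p]. *)
Lemma unit_value_list p :
  Defs.integral_poly v p -> (exists i, v p`_i = Fin 0) ->
  exists us : seq K, (forall u, u \in us -> Fin 0 <= v u) /\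
    forall x, Fin 0 <= v x -> (forall u, u \in us -> v (x - u) <= Fin 0) ->
      v p.[x] = Fin 0.
Proof.
have [n] := ubnP (size p); elim: n p => // n IH p sp ip [i pi].
(* If some integral [u0] has a non-unit value, it lifts a root of the reduction; dividing by
   ['X - u0%:P] leaves the small remainder [p.[u0]] and a shorter quotient for the induction. *)
have [all_unit|] := pselect (forall x, Fin 0 <= v x -> v p.[x] = Fin 0).
  by exists [::]; split=> // x x0 _; exact: all_unit.
move/existsNP => -[u0] /not_implyP[u0_int pu0].
have pu0_gt : Fin 0 < v p.[u0].
  rewrite lt_neqAle eq_sym (poly_in_horner ideal_int) // andbT.
  exact/eqP.
have /factor_theorem[q qE] : root (p - p.[u0]%:P) u0.
  by rewrite /root !hornerE subrr.
have pE : p = q * ('X - u0%:P) + p.[u0]%:P by rewrite -qE subrK.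
have iX := integral_polyXsubC u0_int.
have [iq _] : poly_in (fun x => Fin 0 <= v x) q /\
    poly_in (fun x => Fin 0 <= v x) p.[u0]%:P.
  apply: (poly_in_monic_div ideal_int iX (monicXsubC _)); last by rewrite -pE.
  by rewrite size_XsubC ltnS size_polyC leq_b1.
have [q0|qn0] := eqVneq q 0.
  move: pi; rewrite pE q0 mul0r add0r coefC; case: eqP => _ e.
    by move: pu0_gt; rewrite e ltxx.
  by move: e; rewrite valn0.
(* Were all coefficients of [q] small, so would be those of [p], against its unit coefficient at
   [i]. *)
have [[k qk]|no_unit] := pselect (exists k, v q`_k = Fin 0); last first.
  have qs : poly_in (fun x => Fin 0 < v x) q.
    move=> k; rewrite lt_neqAle eq_sym iq andbT; apply/eqP => e.
    by apply: no_unit; exists k.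
  have : poly_in (fun x => Fin 0 < v x) p.
    rewrite pE mulrC; apply: (poly_inD ideal_small).
      exact: (poly_inM ideal_small).
    exact: (poly_inC ideal_small).
  by move=> /(_ i); rewrite pi ltxx.
have sq : (size q < n)%N.
  rewrite -ltnS; apply: leq_trans sp; rewrite ltnS.
  have <- : size (q * ('X - u0%:P)) = (size q).+1.
    by rewrite size_Mmonic ?monicXsubC // size_XsubC addn2.
  rewrite -qE.
  apply: leq_trans (size_polyD _ _) _; rewrite geq_max leqnn size_polyN size_polyC /=.
  apply: leq_trans (leq_b1 _) _; rewrite size_poly_gt0; apply/eqP => p0.
  by move: pi; rewrite p0 coef0 valn0.
have [us [us_int usP]] := IH q sq iq (ex_intro _ k qk).
exists (u0 :: us); split=> [u|x x0 xus].
  by rewrite inE => /orP[/eqP->//|]; exact: us_int.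
have xu0 : v (x - u0) = Fin 0.
  apply: valn_int_unit; first exact: (valn_idealB ideal_int).
  by apply: xus; rewrite inE eqxx.
have qx : v q.[x] = Fin 0.
  by apply: usP => // u uus; apply: xus; rewrite inE uus orbT.
rewrite pE !hornerE addrC valnD_lt valnM qx xu0 /= addr0 //.
Qed.

Lemma same_reductionC p q : same_reduction v p q -> same_reduction v q p.
Proof. by move=> pq i; rewrite coefB valn_sub -coefB; exact: pq. Qed.

Lemma same_reduction_size p q : p \is monic -> q \is monic ->
  same_reduction v p q -> size p = size q.
Proof.
suff le_size p' q' : p' \is monic -> same_reduction v p' q' -> (size p' <= size q')%N.
  move=> mp mq pq; apply/eqP; rewrite eqn_leq !le_size //.
  exact: same_reductionC.
move=> mp pq; rewrite leqNgt; apply/negP => qp.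
have := pq (size p').-1; rewrite coefB -lead_coefE (monicP mp).
rewrite [q'`_ _]nth_default ?subr0 ?valn1 ?ltxx // -ltnS prednK //.
exact: leq_trans qp.
Qed.

(* The reversed polynomial becomes monic after scaling, since [v g`_0 = 0], and
   reduces to ['X^k * h] with [h] monic of degree [n] and [h`_0] a unit. *)
Lemma henselian_factor g n : henselian v ->
  Defs.integral_poly v g -> v g`_0 = Fin 0 -> v g`_n = Fin 0 ->
  (forall i, (n < i)%N -> Fin 0 < v g`_i) ->
  exists p q, [/\ g = p * q,
    [/\ p \is monic, size p = n.+1 & Defs.integral_poly v p] &
    [/\ Defs.integral_poly v q, v q`_0 = Fin 0 &
        forall i, (0 < i)%N -> Fin 0 < v q`_i]].
Proof.
move=> hens ig g0 gn g_small; set k := size g.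
have g0n0 : g`_0 != 0 by exact: valn_fin_neq0 g0.
pose g1 := (g`_0)^-1 *: g.
have ig1 : Defs.integral_poly v g1.
  by apply: integral_polyZ => //; rewrite valnV_unit.
have vg1 i : v g1`_i = v g`_i by rewrite coefZ valnM_unit // valnV_unit.
have g10 : g1`_0 = 1 by rewrite coefZ mulVf.
have sg1 : (size g1 <= (k + n).+1)%N.
  by rewrite size_scale ?invr_eq0 // leqW // leq_addr.
pose r := poly_rev (k + n) g1; pose h := poly_rev n g1.
have int_rev m : Defs.integral_poly v (poly_rev m g1).
  by move=> i; rewrite coef_poly_rev; case: ifP; rewrite ?valn0.
have [mr szr] : r \is monic /\ size r = (k + n).+1.
  by apply: monic_coef; rewrite ?size_poly_rev // coef_poly_rev leqnn subnn.
have [mh szh] : h \is monic /\ size h = n.+1.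
  by apply: monic_coef; rewrite ?size_poly_rev // coef_poly_rev leqnn subnn.
have h0 : v h`_0 = Fin 0 by rewrite coef_poly_rev leq0n subn0 vg1.
(* Below [k], the coefficients of [r] come from indices of [g1] above [n], hence are small; from [k]
   on they equal those of [h], shifted by [k]. *)
have red_r : same_reduction v r ('X^k * h).
  move=> i; rewrite coefB coefXnM !coef_poly_rev.
  case: ltnP => ik.
    rewrite subr0; case: ifP => _; last by rewrite valn0.
    by rewrite vg1; apply: g_small; lia.
  have -> : (i - k <= n)%N = (i <= k + n)%N by apply/idP/idP; lia.
  case: leqP => ikn; last by rewrite subrr valn0.
  by rewrite (_ : n - (i - k) = k + n - i)%N ?subrr ?valn0 //; lia.
have h0n0 : h`_0 != 0 by exact: valn_fin_neq0 h0.
have /factor_theorem[h1 h1E] : root (h - (h`_0)%:P) 0.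
  by rewrite /root !hornerE horner_coef0 subrr.
rewrite subr0 in h1E.
have hE : h = h1 * 'X + (h`_0)%:P by rewrite -h1E subrK.
have [ih1 _] : poly_in (fun x => Fin 0 <= v x) h1 /\
    poly_in (fun x => Fin 0 <= v x) (h`_0)%:P.
  apply: (poly_in_monic_div ideal_int integral_polyX (monicX _)).
    by rewrite size_polyX ltnS size_polyC leq_b1.
  by rewrite -hE; exact: int_rev.
have h0V : Fin 0 <= v (h`_0)^-1 by rewrite valnV_unit.
(* Up to the unit constant coefficient, [h] is [1 - w] with [w] divisible by ['X]. So [w ^+ k] is a
   multiple of ['X^k], and the geometric sum gives an exact Bezout relation between ['X^k] and
   [h]. *)
pose c := - ((h`_0)^-1 *: h1); pose w := c * 'X.
have ic : Defs.integral_poly v c.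
  by move=> i; rewrite coefN valnN; exact: integral_polyZ.
have iw : Defs.integral_poly v w by apply: integral_polyM => //; exact: integral_polyX.
have wE : (h`_0)^-1 *: h = 1 - w.
  rewrite {2}hE scalerDr /w /c -mul_polyC -mul_polyC -polyCM mulVf //.
  by rewrite -mul_polyC; ring.
have [A [B [[iA iB] [mA mB] rE [redA redB]]]] :
  exists A B, [/\ Defs.integral_poly v A /\ Defs.integral_poly v B,
    A \is monic /\ B \is monic, r = A * B &
    same_reduction v A 'X^k /\ same_reduction v B h].
  apply: hens => //; rewrite ?monicXn //.
  - exact: int_rev.
  - by apply: integral_polyXn; exact: integral_polyX.
  - exact: int_rev.
  exists (c ^+ k), ((h`_0)^-1 *: \sum_(i < k) w ^+ i); split.
  - exact: integral_polyXn.
  - apply: integral_polyZ => // l; rewrite coef_sum.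
    apply: (valn_ideal_sum ideal_int) => m _.
    exact: (@integral_polyXn w m iw l).
  - move=> i; rewrite (_ : _ - 1 = 0) ?coef0 ?valn0 //.
    rewrite -exprMn -/w -scalerAl scalerAr wE.
    by rewrite -{1}[w ^+ k](subrK 1) subrX1; ring.
have szA : size A = k.+1.
  by rewrite (same_reduction_size mA (monicXn _ _) redA) size_polyXn.
have szB : size B = n.+1 by rewrite (same_reduction_size mB mh redB).
have B0 : v B`_0 = Fin 0.
  rewrite -(subrK h`_0 B`_0) valnD_lt h0 //.
  by have := redB 0%N; rewrite coefB.
have B0n0 : B`_0 != 0 by exact: valn_fin_neq0 B0.
(* Reversing back, [B] yields the factor of degree [n], made monic by dividing by its constant
   coefficient, while [A], which reduces to ['X^k], yields one that reduces to a constant. *)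
have gE : g = g`_0 *: (poly_rev k A * poly_rev n B).
  rewrite -poly_revM ?szA ?szB // -rE poly_revK //.
  by rewrite scalerA mulfV // scale1r.
exists ((B`_0)^-1 *: poly_rev n B), ((g`_0 * B`_0) *: poly_rev k A); split.
- rewrite -scalerAl -scalerAr scalerA [_^-1 * _]mulrC mulfK //.
  by rewrite [poly_rev n B * _]mulrC.
- have [mp sp] : (B`_0)^-1 *: poly_rev n B \is monic /\
      size ((B`_0)^-1 *: poly_rev n B) = n.+1.
    apply: monic_coef; first by rewrite size_scale ?invr_eq0 // size_poly_rev.
    by rewrite coefZ coef_poly_rev leqnn subnn mulVf.
  split=> // i; rewrite coefZ valnM_unit ?valnV_unit //.
  by rewrite coef_poly_rev; case: ifP; rewrite ?valn0.
- have gB : v (g`_0 * B`_0) = Fin 0 by rewrite valnM_unit.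
  split=> [i||i i0]; rewrite coefZ valnM_unit // coef_poly_rev.
  + by case: ifP; rewrite ?valn0.
  + by rewrite leq0n subn0 -[k]/(k.+1.-1) -szA -lead_coefE (monicP mA) valn1.
  + case: leqP => ik; last by rewrite valn0.
    have := redA (k - i)%N; rewrite coefB coefXn.
    by rewrite (_ : (k - i == k)%N = false) ?subr0 //; apply/eqP; lia.
Qed.

End Henselian.

(** * Convergence in valued fields *)

Section ValuedConvergence.
Variables (K : fieldType) (G : oagType) (v : valuation K G).
Implicit Types (u : nat -> K) (x y l : K) (g : G).

Lemma valued_cvgP u l :
  ((u : nat -> valued v) @ \oo --> (l : valued v)) <->
  forall g, exists m, forall n, (m <= n)%N -> Fin g < v (u n - l).
Proof.
split=> [ul g|ul A].
  have : nbhs (l : valued v) [set y | Fin g < v ((y : K) - l)].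
    by rewrite nbhs_valuedE; exists g.
  by move/ul => -[m _ mP]; exists m => n mn; exact: mP.
rewrite nbhs_valuedE => -[g _ gA]; have [m mP] := ul g.
by exists m => // n mn; apply: gA; exact: mP.
Qed.

Lemma valued_hausdorff : hausdorff_space (valued v).
Proof.
move=> p q pq; apply/eqP; rewrite -subr_eq0; apply/eqP.
case E: (v ((p : K) - q)) => [g|]; last exact/(valn_eqInfty v).
have near (x : valued v) : nbhs x [set y | Fin g < v ((y : K) - x)].
  by rewrite nbhs_valuedE; exists g.
have [y [yp yq]] := pq _ _ (near p) (near q).
suff : Fin g < v ((p : K) - q) by rewrite E ltxx.
have -> : (p : K) - q = (p - y) + (y - q) by rewrite addrA subrK.
by apply: valn_gtD; rewrite // valn_sub.
Qed.

Lemma cauchy_step_mono u g m :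
  (forall n, (m <= n)%N -> Fin g < v (u n.+1 - u n)) ->
  forall n, (m <= n)%N -> Fin g < v (u n - u m).
Proof.
move=> step n /subnKC <-; elim: (n - m)%N => [|k IH].
  by rewrite addn0 subrr valn0 extval_lt_Infty.
have -> : u (m + k.+1)%N - u m = (u (m + k).+1 - u (m + k)%N) + (u (m + k)%N - u m).
  by rewrite addrA subrK addnS.
by apply: valn_gtD => //; apply: step; rewrite leq_addr.
Qed.

(** By the ultrametric inequality, small consecutive differences already keep a whole tail in the
    ball around [u m]. *)
Lemma valued_complete_cvg u : complete_valued v ->
  (forall g, exists m, forall n, (m <= n)%N -> Fin g < v (u n.+1 - u n)) ->
  exists l, forall g, exists m, forall n, (m <= n)%N -> Fin g < v (u n - l).
Proof.
move=> compl step.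
have : cvg ((u : nat -> valued v) @ \oo).
  apply: compl => E [g _ gE]; have [m mP] := step g.
  pose A := [set y : valued v | Fin g < v ((y : K) - u m)].
  have FA : ((u : nat -> valued v) @ \oo) A.
    by exists m => // n mn; exact: cauchy_step_mono mP _ mn.
  exists (A, A); first by split.
  move=> [x y] [/= Ax Ay]; apply: gE => /=.
  have -> : (x : K) - y = (x - u m) + (u m - y) by rewrite addrA subrK.
  by apply: valn_gtD => //; rewrite valn_sub.
by move/cvg_ex => -[l /valued_cvgP ul]; exists l.
Qed.

(** Valuations are locally constant off [0] and grow without bound near [0], so they pass to limits.
    The element [z] varies with [n]: it need only share its valuation with [u n], so [u] itself need
    not approach [x]. *)
Lemma valued_cvg_valn_eq u l x :
  (forall g, exists m, forall n, (m <= n)%N -> Fin g < v (u n - l)) ->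
  (forall g, exists m, forall n, (m <= n)%N ->
     exists2 z, v (u n) = v z & Fin g < v (z - x)) ->
  v l = v x.
Proof.
move=> ul ux.
have close y (g : G) : v y = Fin g -> forall z, Fin g < v (z - y) -> v z = Fin g.
  by move=> yg z zy; rewrite -(subrK y z) valnD_lt yg.
have small y : v y = Infty -> forall z (g : G), Fin g < v (z - y) -> Fin g < v z.
  by move=> /valn_eqInfty -> z g; rewrite subr0.
case El: (v l) => [g|]; case Ex: (v x) => [h|] //.
- have [m mP] := ul (Order.max g h); have [m' mP'] := ux (Order.max g h).
  have /mP un := leq_maxl m m'; have /mP' [z uz zx] := leq_maxr m m'.
  rewrite -(close _ _ El (u (maxn m m'))); last first.
    by apply: le_lt_trans un; rewrite extval_leE le_max lexx.
  rewrite uz; apply: (close _ _ Ex); apply: le_lt_trans zx.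
  by rewrite extval_leE le_max lexx orbT.
- have [m mP] := ul g; have [m' mP'] := ux g.
  have /mP un := leq_maxl m m'; have /mP' [z uz zx] := leq_maxr m m'.
  have := small _ Ex z g zx.
  by rewrite -uz (close _ _ El _ un) ltxx.
- have [m mP] := ul h; have [m' mP'] := ux h.
  have /mP un := leq_maxl m m'; have /mP' [z uz zx] := leq_maxr m m'.
  have := small _ El _ h un.
  by rewrite uz (close _ _ Ex _ zx) ltxx.
Qed.

Section Series.
Variable c : nat -> K.

(** The terms of the series tend to [0] at points of value [g]. Over a complete field this is
    equivalent to convergence there, and it mentions only [g], not the point. *)
Definition ps_null (g : G) := forall h : G, exists m, forall n, (m <= n)%N ->
  Fin h < extval_add (v (c n)) (Fin (g *+ n)).

Lemma ps_sumsS x n : ps_sums v c x n.+1 - ps_sums v c x n = c n * x ^+ n.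
Proof. by rewrite /ps_sums seriesSr addrC addKr. Qed.

Lemma ps_sums_horner x n : ps_sums v c x n = (\poly_(i < n) c i).[x].
Proof. by rewrite /ps_sums /series /= horner_poly big_mkord. Qed.

Lemma ps_cvg_limP x : ps_cvg v c x -> forall g, exists m, forall n, (m <= n)%N ->
  Fin g < v ((ps_sums v c x n : K) - ps_eval v c x).
Proof. by move=> cx; apply/valued_cvgP; exact: cx. Qed.

Lemma ps_cvg_null x g : ps_cvg v c x -> v x = Fin g -> ps_null g.
Proof.
move=> cx xg h; have [m mP] := ps_cvg_limP cx h; exists m => n mn.
rewrite -(valnX n xg) -valnM -ps_sumsS.
set l := ps_eval v c x in mP.
have -> : (ps_sums v c x n.+1 : K) - ps_sums v c x n =
    (ps_sums v c x n.+1 - l) + (l - ps_sums v c x n) :> K by rewrite addrA subrK.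
by apply: valn_gtD; [exact/mP/leqW | rewrite valn_sub; exact: mP].
Qed.

Lemma ps_null_cvg x g : complete_valued v -> v x = Fin g -> ps_null g -> ps_cvg v c x.
Proof.
move=> compl xg cg.
have [|l ul] := @valued_complete_cvg (ps_sums v c x) compl.
  move=> h; have [m mP] := cg h; exists m => n mn.
  by rewrite ps_sumsS valnM (valnX n xg); exact: mP.
by apply/cvg_ex; exists l; exact/valued_cvgP.
Qed.

(** Partial sums tending to [0] give convergence and vanishing at once, so no completeness is
    required; this is how zeros in [Lbar] are recognized. *)
Lemma ps_zerosP x : ps_zeros v c x <->
  forall g, exists m, forall n, (m <= n)%N -> Fin g < v (ps_sums v c x n : K).
Proof.
split=> [[cx ex] g|ux].
  have [m mP] := ps_cvg_limP cx g; exists m => n /mP.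
  by rewrite ex subr0.
have u0 : (ps_sums v c x : nat -> valued v) @ \oo --> (0 : valued v).
  by apply/valued_cvgP => g; have [m mP] := ux g; exists m => n; rewrite subr0; exact: mP.
split; first by apply/cvg_ex; exists 0.
exact: (cvg_lim valued_hausdorff u0).
Qed.

Lemma ps_null_le g h : g <= h -> ps_null g -> ps_null h.
Proof.
move=> gh cg k; have [m mP] := cg k; exists m => n /mP kn.
apply: lt_le_trans kn _; rewrite extval_leD // extval_leE.
exact: oag_leMn.
Qed.

(** The values [v(c k) + k g] eventually exceed the finite one at [n0], so their minimum is that of
    a finite prefix and is attained only finitely often. The last such index is the Weierstrass
    degree. *)
Lemma ps_null_last_min n0 g : c n0 != 0 -> ps_null g ->
  exists n, [/\ c n != 0,
    forall k, extval_add (v (c n)) (Fin (g *+ n)) <= extval_add (v (c k)) (Fin (g *+ k)) &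
    forall k, (n < k)%N ->
      extval_add (v (c n)) (Fin (g *+ n)) < extval_add (v (c k)) (Fin (g *+ k))].
Proof.
move=> c0 cg; set e := fun k => extval_add (v (c k)) (Fin (g *+ k)).
have prefix m : exists n, [/\ (n <= m)%N, forall k, (k <= m)%N -> e n <= e k &
    forall k, (n < k <= m)%N -> e n < e k].
  elim: m => [|m [n [nm min_n last_n]]].
    by exists 0%N; split=> // k; [rewrite leqn0 => /eqP -> | case: k].
  have [mn|nm1] := leP (e m.+1) (e n).
    exists m.+1; split=> // k; last by case/andP => /leq_trans h /h; rewrite ltnn.
    by rewrite leq_eqVlt ltnS => /orP[/eqP->//|/min_n]; exact: le_trans.
  exists n; split=> [|k|k]; first exact: leqW.
    by rewrite leq_eqVlt ltnS => /orP[/eqP->|/min_n//]; exact: ltW.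
  rewrite [(k <= _)%N]leq_eqVlt ltnS => /andP[nk /orP[/eqP->//|km]].
  by apply: last_n; rewrite nk.
have [a ca] := valn_neq0 v c0.
have en0 : e n0 = Fin (a + g *+ n0) by rewrite /e ca.
have [m mP] := cg (a + g *+ n0); have [n [nm min_n last_n]] := prefix (maxn m n0).
have tail k : (maxn m n0 < k)%N -> e n < e k.
  move=> mk; apply: le_lt_trans (min_n _ (leq_maxr _ _)) _.
  by rewrite en0; apply: mP; apply: leq_trans (ltnW mk); exact: leq_maxl.
exists n; split=> [|k|k nk].
- apply/eqP => cn0; have := min_n _ (leq_maxr m n0).
  by rewrite en0 /e cn0 valn0.
- by have [/min_n//|/tail/ltW] := leqP k (maxn m n0).
- by have [kl|/tail//] := leqP k (maxn m n0); apply: last_n; rewrite nk.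
Qed.

End Series.

End ValuedConvergence.

(** * Weierstrass factorization in the limit *)

Section Weierstrass.
Variables (L : fieldType) (G : oagType) (v : valuation L G).
Implicit Types (p q f : {poly L}) (g : G).

Let ideal_int := valn_ideal_ge v (Fin 0).
Let ideal_small := valn_ideal_gt v 0.

(** The reduction is a non-zero constant, so such a polynomial has valuation [0] at all integral
    points, including those of an extension. *)
Definition unit_const_poly q :=
  [/\ Defs.integral_poly v q, v q`_0 = Fin 0 & forall i, (0 < i)%N -> Fin 0 < v q`_i].

(* Modulo [p], the factor [q'] acts on the remainder [p' - p] as the unit
   [q'`_0] up to an operator that raises valuations. *)
Lemma monic_factor_close p p' q q' n g :
  p \is monic -> size p = n.+1 -> Defs.integral_poly v p ->
  p' \is monic -> size p' = n.+1 -> unit_const_poly q' ->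
  poly_in (fun x => Fin g < v x) (p' * q' - p * q) ->
  poly_in (fun x => Fin g < v x) (p' - p).
Proof.
move=> mp szp ip mp' szp' [iq' q'0 q'_small] pq.
set d := p' - p.
have szd : (size d < size p)%N.
  rewrite szp ltnS; apply/leq_sizeP => i; rewrite leq_eqVlt => /orP[/eqP <-|ni].
    have p'n : p'`_n = 1 by have := monicP mp'; rewrite lead_coefE szp'.
    have pn : p`_n = 1 by have := monicP mp; rewrite lead_coefE szp.
    by rewrite coefB p'n pn subrr.
  by rewrite coefB !nth_default ?subrr // ?szp ?szp'.
have [//|/existsNP[i0 /negP]] := pselect (poly_in (fun x => Fin g < v x) d).
rewrite -leNgt => di0.
(* Assuming the conclusion fails, the least valuation [e] of a coefficient of [d] is at most [g];
   the contradiction will be that all of them exceed [e]. *)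
have [i [di min_i]] : exists i, v d`_i <= Fin g /\ forall k, v d`_i <= v d`_k.
  have i0n : (i0 < n.+1)%N.
    rewrite -szp ltnNge; apply/negP => szi; move: di0.
    by rewrite nth_default ?valn0 // (leq_trans (ltnW szd)).
  case: (@arg_minP _ _ _ (Ordinal i0n) xpredT (fun k : 'I_n.+1 => v d`_k))
    => // i _ min_i.
  exists i; split; first exact: le_trans (min_i (Ordinal i0n) _) di0.
  move=> k; have [kn|nk] := ltnP k n.+1; first exact: (min_i (Ordinal kn)).
  rewrite [d`_k]nth_default ?valn0 ?extval_leInfty //.
  by apply: leq_trans nk; rewrite -szp ltnW.
have [e Ed] : exists e, v d`_i = Fin e by case: (v d`_i) di => [e|//]; exists e.
rewrite Ed in di min_i.
have ideal_e := valn_ideal_gt v e.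
pose q1 := q' - (q'`_0)%:P.
have dq1 : poly_in (fun x => Fin e < v x) (d * q1).
  move=> k; rewrite coefM; apply: (valn_ideal_sum ideal_e) => l _.
  rewrite valnM extval_addC -[Fin e]extval_add0.
  case E: (v d`_l) => [h|]; last by case: (v q1`_(k - l)) => *; exact: extval_lt_Infty.
  apply: extval_ltD => //; last by rewrite -E.
  rewrite /q1 coefB coefC; case: eqP => [->|/eqP kl].
    by rewrite subrr valn0 extval_lt_Infty.
  by rewrite subr0; apply: q'_small; rewrite lt0n.
have pqe : poly_in (fun x => Fin e < v x) (p' * q' - p * q).
  by move=> k; apply: le_lt_trans (pq k).
(* The right-hand side has coefficients above [e], and on the left the multiple of [d] is its
   remainder modulo [p], so monic division carries the bound over to [d]. *)
have dE : (q' - q) * p + q'`_0 *: d = (p' * q' - p * q) - d * q1.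
  by rewrite /q1 /d -mul_polyC; ring.
have [] := poly_in_monic_div ideal_e ip mp (q := q' - q) (r := q'`_0 *: d).
- by rewrite size_scale // (valn_fin_neq0 q'0).
- by rewrite dE; exact: (poly_inB ideal_e).
by move=> _ /(_ i); rewrite coefZ valnM_unit // Ed ltxx.
Qed.

(** Only the monic factors, of fixed degree [n], pass to the limit coefficient by coefficient. The
    cofactors [q] may grow in degree and stay attached to each stage, as only their unit values
    matter. *)
Lemma henselian_factor_lim (f : nat -> {poly L}) n :
  henselian v -> complete_valued v ->
  (forall k, [/\ Defs.integral_poly v (f k), v (f k)`_0 = Fin 0,
     v (f k)`_n = Fin 0 & forall i, (n < i)%N -> Fin 0 < v (f k)`_i]) ->
  (forall g, exists m, forall k, (m <= k)%N ->
     poly_in (fun x => Fin g < v x) (f k.+1 - f k)) ->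
  exists P : {poly L}, [/\ P \is monic, Defs.integral_poly v P &
    forall g, exists m, forall k, (m <= k)%N -> exists p q,
      [/\ f k = p * q, poly_in (fun x => Fin g < v x) (p - P) & unit_const_poly q]].
Proof.
move=> hens compl fP f_cauchy.
have /choice[pq pqP] k : exists pq : {poly L} * {poly L}, [/\ f k = pq.1 * pq.2,
    [/\ pq.1 \is monic, size pq.1 = n.+1 & Defs.integral_poly v pq.1] &
    unit_const_poly pq.2].
  have [fi f0 fn fs] := fP k.
  have [p [q [fE pP qP]]] := henselian_factor hens fi f0 fn fs.
  by exists (p, q).
pose p k := (pq k).1.
have p_cauchy g : exists m, forall k, (m <= k)%N ->
    poly_in (fun x => Fin g < v x) (p k.+1 - p k).
  have [m mP] := f_cauchy g; exists m => k /mP fk.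
  have [fE [mp szp ip] _] := pqP k; have [fE' [mp' szp' _] qP'] := pqP k.+1.
  apply: (monic_factor_close (q := (pq k).2) mp szp ip mp' szp' qP').
  by rewrite /p -fE -fE'.
have /choice[c cP] i : exists l, forall g, exists m, forall k, (m <= k)%N ->
    Fin g < v ((p k)`_i - l).
  apply: valued_complete_cvg compl _ => g; have [m mP] := p_cauchy g.
  by exists m => k mk; rewrite -coefB; exact: mP.
have int_lim i : Fin 0 <= v (c i).
  have [m mP] := cP i 0; rewrite -(subKr (p m)`_i (c i)).
  apply: (valn_idealB ideal_int); last exact/ltW/mP.
  by have [_ [_ _ ip] _] := pqP m; exact: ip.
have c_n : c n = 1.
  apply/esym/eqP; rewrite -subr_eq0; apply/eqP.
  case E: (v (1 - c n)) => [g|]; last exact/(valn_eqInfty v).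
  have [m mP] := cP n g; have [_ [mp szp _] _] := pqP m.
  have pn : (p m)`_n = 1 by have := monicP mp; rewrite lead_coefE szp.
  by have := mP m (leqnn m); rewrite pn E ltxx.
have [mP _] : \poly_(i < n.+1) c i \is monic /\ size (\poly_(i < n.+1) c i) = n.+1.
  by apply: monic_coef; rewrite ?size_poly // coef_poly ltnSn.
exists (\poly_(i < n.+1) c i); split=> // [i|g].
  by rewrite coef_poly; case: ifP; rewrite ?valn0.
have /choice[m mE] i := cP i g.
exists (\max_(i < n.+1) m i) => k mk; exists (pq k).1, (pq k).2.
have [fE [_ szp _] qP] := pqP k; split=> // i; rewrite coefB coef_poly.
case: ltnP => ni; last by rewrite nth_default ?szp // subrr valn0 extval_lt_Infty.
by apply: mE; apply: leq_trans mk; exact: (leq_bigmax (Ordinal ni)).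
Qed.

Lemma poly_in_comp (I : L -> Prop) p q : valn_ideal v I ->
  Defs.integral_poly v q -> poly_in I p -> poly_in I (p \Po q).
Proof.
move=> II iq Ip i; rewrite comp_polyE coef_sum.
apply: (valn_ideal_sum II) => k _; rewrite coefZ mulrC.
by case: (II) => _ _ M; apply: M => //; exact: (integral_polyXn _ iq).
Qed.

(* The shift by [u] makes the constant coefficient a unit. *)
Lemma henselian_series_factor (t : nat -> L) n u :
  henselian v -> complete_valued v ->
  (forall k, Fin 0 <= v (t k)) -> v (t n) = Fin 0 ->
  (forall k, (n < k)%N -> Fin 0 < v (t k)) ->
  (forall g, exists m, forall k, (m <= k)%N -> Fin g < v (t k)) ->
  Fin 0 <= v u -> v (\poly_(i < n.+1) t i).[u] = Fin 0 ->
  exists P : {poly L}, [/\ P \is monic, Defs.integral_poly v P &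
    forall g, exists m, forall k, (m <= k)%N -> exists p q,
      [/\ (\poly_(i < k) t i) \Po ('X + u%:P) = p * q,
          poly_in (fun x => Fin g < v x) (p - P) & unit_const_poly q]].
Proof.
move=> hens compl t_int tn t_small t_lim u_int fu.
pose F k := \poly_(i < k) t i; pose X := 'X + u%:P.
have iX : Defs.integral_poly v X.
  rewrite /X -[u]opprK polyCN; apply: integral_polyXsubC.
  by rewrite valnN.
have F_split k : poly_in (fun x => Fin 0 < v x) (F (n.+1 + k)%N - F n.+1).
  move=> i; rewrite coefB !coef_poly.
  case: (ltnP i n.+1) => ni; first by rewrite ltn_addr // subrr valn0 extval_lt_Infty.
  by rewrite subr0; case: ifP => _; rewrite ?valn0 ?extval_lt_Infty //; exact: t_small.
(* Translation keeps degree and leading coefficient of the truncation at [n]. Longer truncations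
   differ from it by small coefficients, so the required reduction is inherited from this one. *)
have Fn_comp i : (n <= i)%N -> (F n.+1 \Po X)`_i = if i == n then t n else 0.
  have tn0 : t n != 0 by exact: valn_fin_neq0 tn.
  have szF : size (F n.+1) = n.+1 by rewrite size_poly_eq.
  have szX : size X = 2 by rewrite size_XaddC.
  have szFX : size (F n.+1 \Po X) = n.+1 by rewrite size_comp_poly2.
  rewrite leq_eqVlt => /orP[/eqP <-|ni].
    rewrite eqxx.
    have := @lead_coef_comp _ (F n.+1) X; rewrite szX => /(_ isT).
    rewrite !lead_coefE szFX szF szX /= coef_poly ltnSn coefD coefX coefC.
    by rewrite addr0 expr1n mulr1.
  by rewrite gtn_eqF // nth_default // szFX.
have unit_near x y : v x = Fin 0 -> Fin 0 < v (y - x) -> v y = Fin 0.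
  by move=> x0 yx; rewrite -(subrK x y) valnD_lt x0.
have comp_near k i : Fin 0 < v ((F (n.+1 + k)%N \Po X)`_i - (F n.+1 \Po X)`_i).
  by rewrite -coefB -comp_polyB; exact: (poly_in_comp ideal_small).
(* The sequence starts at [F n.+1], since shorter truncations lack the unit coefficient [t n]. *)
have [k|g|P [mP iP PP]] :=
  @henselian_factor_lim (fun k => F (n.+1 + k)%N \Po X) n hens compl.
- split.
  + apply: (poly_in_comp ideal_int iX) => i; rewrite coef_poly.
    by case: ifP; rewrite ?valn0.
  + apply: unit_near (comp_near k 0%N).
    by rewrite -horner_coef0 horner_comp !hornerE.
  + by apply: unit_near (comp_near k n); rewrite Fn_comp // eqxx.
  + move=> i ni; have := comp_near k i.
    by rewrite Fn_comp 1?ltnW // gtn_eqF // subr0.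
- have [m mP] := t_lim g; exists m => k mk; rewrite -comp_polyB.
  apply: (poly_in_comp (valn_ideal_gt v g) iX) => i; rewrite coefB !coef_poly addnS ltnS.
  case: ltngtP => ik; rewrite ?subrr ?valn0 ?extval_lt_Infty // subr0 ik.
  by apply: mP; rewrite (leq_trans mk) // leq_addl.
exists P; split=> // g; have [m mE] := PP g; exists (n.+1 + m)%N => k mk.
have nk : (n.+1 <= k)%N by apply: leq_trans mk; exact: leq_addr.
rewrite -[k](subnKC nk); apply: mE.
by rewrite -(leq_add2l n.+1) subnKC.
Qed.

End Weierstrass.

(** * Generic points over an infinite residue field *)

Section Residue.
Variables (G : oagType) (K M : fieldType) (vK : valuation K G) (vM : valuation M G).
Variable iota : {rmorphism K -> M}.
Hypothesis iota_val : forall x : K, vM (iota x) = vK x.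

(** Each open unit ball of [M] meets [K] in at most one residue class, so finitely many of them
    cannot exhaust an infinite residue field. *)
Lemma residue_avoid (ds : seq M) : infinite_set (residue_field vK) ->
  exists2 t : K, Fin 0 <= vK t & forall d, d \in ds -> vM (iota t - d) <= Fin 0.
Proof.
move=> inf; apply: contrapT => no_t; apply: inf.
pose ball d := [set x : K | Fin 0 < vM (iota x - d)].
apply: (@sub_finite_set _ _ (ball @` [set` ds])); last first.
  by apply: finite_image; exact: finite_seq.
move=> A [a a_int ->].
have [d dds ad] : exists2 d, d \in ds & Fin 0 < vM (iota a - d).
  apply: contrapT => no_d; apply: no_t; exists a => // d dds.
  by rewrite leNgt; apply/negP => ad; apply: no_d; exists d.
exists d => //; rewrite eqEsubset; split=> x /= xd.
  rewrite -iota_val rmorphB.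
  have -> : iota x - iota a = (iota x - d) + (d - iota a) by rewrite addrA subrK.
  by apply: valn_gtD => //; rewrite valn_sub.
rewrite /ball /=.
have -> : iota x - d = (iota x - iota a) + (iota a - d) by rewrite addrA subrK.
by apply: valn_gtD => //; rewrite -rmorphB iota_val.
Qed.

(** With [t = s * w] and [v(w) = g], the ultrametric minimum can fail only if [v(x0 - c) = g] and
    [s] lies in the residue class of [(c - x0) / w]; [s] is chosen off these finitely many
    classes. *)
Lemma generic_shift (x0 : K) (g : G) (cs : seq M) : infinite_set (residue_field vK) ->
  exists2 t : K, vK t = Fin g &
    forall c, c \in cs -> vM (iota (x0 + t) - c) = Order.min (Fin g) (vM (iota x0 - c)).
Proof.
move=> inf; have [w wg] := valn_onto vK g.
have w0 : w != 0 by exact: valn_fin_neq0 wg.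
have iw0 : iota w != 0 by rewrite fmorph_eq0.
(* The entry [0] forces [s] to be a unit, so that [s * w] has value exactly [g]. *)
have [s s_int s_avoid] := residue_avoid (0 :: [seq (c - iota x0) / iota w | c <- cs]) inf.
have s_unit : vK s = Fin 0.
  apply: valn_int_unit => //; rewrite -iota_val -(subr0 (iota s)).
  by apply: s_avoid; rewrite inE eqxx.
have tg : vK (s * w) = Fin g by rewrite valnM_unit.
exists (s * w) => // c ccs; rewrite rmorphD.
have tM : vM (iota (s * w)) = Fin g by rewrite iota_val.
have sE : iota x0 + iota (s * w) - c = iota (s * w) + (iota x0 - c) by ring.
rewrite sE; case: (ltgtP (Fin g) (vM (iota x0 - c))) => gc.
- by rewrite addrC valnD_lt ?tM.
- by rewrite valnD_lt ?tM.
have lb : Fin g <= vM (iota (s * w) + (iota x0 - c)).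
  by apply: le_trans (valnD _ _ _); rewrite le_min tM -gc lexx.
apply/eqP; rewrite eq_le lb andbT.
have -> : iota (s * w) + (iota x0 - c) = (iota s - (c - iota x0) / iota w) * iota w.
  by rewrite mulrBl divfK // rmorphM; ring.
rewrite valnM iota_val wg extval_addC.
apply: (@le_trans _ _ (extval_add (Fin g) (Fin 0))); last by rewrite /= addr0.
rewrite extval_leD2l; apply: s_avoid.
by rewrite inE; apply/orP; right; apply/mapP; exists c.
Qed.

End Residue.

(** * Piecewise linear functions and order topologies *)

Section TruncatedSums.
Variable G : oagType.
Implicit Types (es : seq (extval G)) (g h l : G).

Definition trunc l (e : extval G) : G := if e is Fin h then Order.min l h else l.

Lemma truncE l e : Fin (trunc l e) = Order.min (Fin l) e.
Proof.
case: e => [h|] /=; last by rewrite min_l ?extval_leInfty.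
by rewrite /Order.min /= extval_ltE; case: ifP.
Qed.

Lemma trunc_id l e : Fin l <= e -> trunc l e = l.
Proof. by move=> le; have := truncE l e; rewrite min_l // => -[]. Qed.

Lemma trunc_le_mono g h e : g <= h -> trunc g e <= trunc h e.
Proof.
move=> gh; rewrite -extval_leE !truncE le_min !ge_min lexx orbT andbT.
by rewrite extval_leE gh.
Qed.

Lemma trunc_le_lip g h e : g <= h -> trunc h e <= trunc g e + (h - g).
Proof.
move=> gh; have hg0 : 0 <= h - g by rewrite oag_subr_ge0.
case: e => [k|] /=; last by rewrite addrC subrK.
have [gk|kg] := leP g k; first by rewrite addrC subrK ge_min lexx.
by rewrite -[X in X <= _]addr0 oag_leD // ge_min lexx orbT.
Qed.

(** The sum is piecewise linear in [l] with integer slopes, so each piece can be solved by division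
    in [G]. On a sorted list, either dividing [g] by the length gives an [l] below every entry, or
    the smallest entry contributes itself and the tail must supply the rest. *)
Lemma trunc_sum_ivt es a g : divisible_group G ->
  (forall e, e \in es -> Fin a <= e) -> a *+ size es <= g ->
  Fin g <= \big[@extval_add G/Fin 0]_(e <- es) e ->
  exists2 l, a <= l & \sum_(e <- es) trunc l e = g.
Proof.
move=> div; wlog sorted_es : es / sorted <=%O es.
  move=> wlog_sorted a_le a_g g_le.
  have perm_es := permEl (perm_sort <=%O es).
  have [|e|||l al sum_l] := wlog_sorted (sort <=%O es).
  - exact: sort_sorted le_total _.
  - by rewrite mem_sort; exact: a_le.
  - by rewrite size_sort.
  - by rewrite (perm_big _ perm_es).
  by exists l => //; rewrite -(perm_big _ perm_es).
elim: es a g sorted_es => [|e es IH] a g sorted_es a_le a_g g_le.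
  exists a => //; move: g_le a_g; rewrite !big_nil extval_leE mulr0n => g0 ag.
  by apply/le_anti; rewrite ag g0.
have [l lE] := div (size es).+1 g isT.
have al : a <= l by rewrite -(oag_leMnE _ _ (ltn0Sn (size es))) lE.
have e_le : forall e', e' \in es -> e <= e'.
  by apply/allP; apply: order_path_min sorted_es; exact: le_trans.
have [le|el] := leP (Fin l) e.
  exists l => //; rewrite big_cons trunc_id // -lE mulrS; congr (_ + _).
  rewrite big_seq (eq_bigr (fun=> l)) -?big_seq ?big_const_seq ?count_predT.
    by rewrite iter_addr_0.
  by move=> e' /e_le ee'; rewrite trunc_id //; exact: le_trans ee'.
have [h eE] := extval_lt_fin el; move: el; rewrite eE extval_ltE => hl.
have ah : a <= h by rewrite -extval_leE -eE; apply: a_le; rewrite inE eqxx.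
have [|e'|||l' hl' sum_l'] := IH h (g - h).
- exact: path_sorted sorted_es.
- by rewrite -eE; exact: e_le.
- by rewrite -(oag_leD2lE h) [h + (g - h)]addrC subrK -mulrS -lE oag_leMn // ltW.
- rewrite -(extval_leD2l h) /= [h + (g - h)]addrC subrK.
  by move: g_le; rewrite big_cons eE.
exists l'; first exact: le_trans hl'.
by rewrite big_cons sum_l' /= min_r // addrC subrK.
Qed.

Lemma extval_sum_fin (I : Type) (s : seq I) (f : I -> G) :
  \big[@extval_add G/Fin 0]_(i <- s) Fin (f i) = Fin (\sum_(i <- s) f i).
Proof. by elim: s => [|i s IH]; rewrite ?big_nil // !big_cons IH. Qed.

Lemma extval_le_sum (I : eqType) (s : seq I) (E F : I -> extval G) :
  (forall i, i \in s -> E i <= F i) ->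
  \big[@extval_add G/Fin 0]_(i <- s) E i <= \big[@extval_add G/Fin 0]_(i <- s) F i.
Proof.
elim: s => [|i s IH] EF; first by rewrite !big_nil.
rewrite !big_cons extval_leD //; first by apply: EF; rewrite inE eqxx.
by apply: IH => k ks; apply: EF; rewrite inE ks orbT.
Qed.

Lemma sum_const_seq (I : Type) (s : seq I) g : \sum_(i <- s) g = g *+ size s.
Proof. by rewrite big_const_seq count_predT iter_addr_0. Qed.

End TruncatedSums.

Section OrderContinuity.
Variable G : oagType.

Lemma oag_exists_pos : (exists g : G, g != 0) -> exists g : G, 0 < g.
Proof.
move=> [g g0]; have [gp|gn] := ltP (0 : G) g; first by exists g.
exists (- g); rewrite -(oag_ltD2lE g) addr0 subrr.
by rewrite lt_neqAle g0.
Qed.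

(** Turns an order neighbourhood of a finite point into a radius usable with Lipschitz bounds. On a
    side without a finite bound, any positive [p] serves. *)
Lemma extval_itv_ball (i : interval (extval G)) (g : G) :
  (exists g : G, g != 0) -> itv_open_ends i -> Fin g \in i ->
  exists2 e : G, 0 < e & forall h, g < h + e -> h < g + e -> Fin h \in i.
Proof.
move=> /oag_exists_pos[p p0] oi gi.
have [e1 e10 e1P] : exists2 e1 : G, 0 < e1 &
    forall h, g < h + e1 -> (let: Interval a _ := i in a <= BLeft (Fin h))%O.
  case: i oi gi => [[b x|b] r] oi; rewrite itv_boundlr => /andP[xg _].
    have b0 := itv_open_ends_lside oi; rewrite b0 in xg *.
    have {xg} xg : x < Fin g by [].
    have [k xk] := extval_lt_fin xg; rewrite xk extval_ltE in xg.
    exists (g - k); first by rewrite oag_subr_gt0.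
    move=> h; rewrite addrCA -{1}[g]addr0 oag_ltD2lE oag_subr_gt0 => kh.
    by rewrite bnd_simp xk extval_ltE.
  by rewrite (itv_open_ends_linfty oi) in xg *; exists p.
have [e2 e20 e2P] : exists2 e2 : G, 0 < e2 &
    forall h, h < g + e2 -> (let: Interval _ b := i in BRight (Fin h) <= b)%O.
  case: i oi gi {e1P} => [l [b x|b]] oi; rewrite itv_boundlr => /andP[_ xg].
    have b0 := itv_open_ends_rside oi; rewrite b0 in xg *.
    have {xg} xg : Fin g < x by [].
    case: x xg oi => [k|] xg oi; last first.
      by exists p => // h _; rewrite bnd_simp extval_lt_Infty.
    rewrite extval_ltE in xg; exists (k - g); first by rewrite oag_subr_gt0.
    by move=> h; rewrite addrC subrK => kh; rewrite bnd_simp extval_ltE.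
  by rewrite (itv_open_ends_rinfty oi) in xg *; exists p.
exists (Order.min e1 e2); first by rewrite lt_min e10 e20.
move=> h gh hg; case: i {oi gi} e1P e2P => [l r] lP rP; rewrite itv_boundlr.
apply/andP; split; [apply: lP|apply: rP].
  by apply: lt_le_trans gh _; rewrite oag_leD2lE ge_min lexx.
by apply: lt_le_trans hg _; rewrite oag_leD2lE ge_min lexx orbT.
Qed.

Lemma lipschitz_within_cvg (A U : set (order_topology G)) (f : G -> extval G)
    (F : G -> G) (a : G) n :
  (exists g : G, g != 0) -> divisible_group G ->
  A a -> nbhs (a : order_topology G) U ->
  (forall x, A x -> U x -> f x = Fin (F x)) ->
  (forall x y, A x -> U x -> A y -> U y -> x <= y ->
     F x <= F y /\ F y <= F x + (y - x) *+ n) ->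
  (f : order_topology G -> order_topology (extval G)) @
    within A (nbhs (a : order_topology G)) --> (f a : order_topology (extval G)).
Proof.
move=> nontriv div Aa Ua fF lip B.
have Uaa : U a by exact: nbhs_singleton Ua.
rewrite fF // order_nbhs_itv => -[i [oi ai] iB].
have [e e0 eP] := extval_itv_ball nontriv oi ai.
(* Dividing by [n.+1] rather than [n] makes [d *+ n < e] strict and covers [n = 0]. *)
have [d dE] := div n.+1 e isT.
have d0 : 0 < d.
  by rewrite ltNge; apply/negP => /(oag_leMn n.+1); rewrite mul0rn dE leNgt e0.
have dn : d *+ n < e by rewrite -dE mulrSr -[X in X < _]addr0 oag_ltD2lE.
have nbhs_a : nbhs (a : order_topology G) [set x | x < a + d /\ a < x + d].
  rewrite order_nbhs_itv; exists `](a - d), (a + d)[; first split.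
  - by [].
  - rewrite in_itv /= -(oag_ltD2rE d) subrK -{1}[a]addr0 oag_ltD2lE d0 /=.
    by rewrite -{1}[a]addr0 oag_ltD2lE.
  move=> x /=; rewrite in_itv /= => /andP[ax xa]; split=> //.
  by rewrite -(oag_ltD2rE (- d)) addrK.
suff : nbhs (a : order_topology G) [set x | A x -> B (f x)] by [].
apply: filterS (filterI Ua nbhs_a) => x [Ux [xa ax]] Ax.
apply: iB => /=; rewrite fF //; apply: eP.
  have [le_xa|lt_ax] := leP x a.
    have [_ /le_lt_trans] := lip x a Ax Ux Aa Uaa le_xa; apply.
    rewrite oag_ltD2lE; apply: le_lt_trans dn; apply: oag_leMn.
    by rewrite -(oag_leD2lE x) addrC subrK ltW.
  have [Fax _] := lip a x Aa Uaa Ax Ux (ltW lt_ax).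
  by rewrite -[X in X < _]addr0 addrC [X in _ < X]addrC oag_ltD.
have [le_xa|lt_ax] := leP x a.
  have [Fxa _] := lip x a Ax Ux Aa Uaa le_xa.
  by rewrite -[X in X < _]addr0 addrC [X in _ < X]addrC oag_ltD.
have [_ /le_lt_trans] := lip a x Aa Uaa Ax Ux (ltW lt_ax); apply.
rewrite oag_ltD2lE; apply: le_lt_trans dn; apply: oag_leMn.
by rewrite -(oag_leD2lE a) addrC subrK ltW.
Qed.

End OrderContinuity.

(** * Zeros and values of a power series *)

Section IntegralRoots.
Variables (M : fieldType) (G : oagType) (v : valuation M G).

(** If [v(x) < 0], the leading term dominates: induction along the Horner scheme keeps the value of
    [p] at [x] non-positive, whereas at a root it is [Infty]. *)
Lemma monic_root_integral (p : {poly M}) (x : M) :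
  p \is monic -> Defs.integral_poly v p -> root p x -> Fin 0 <= v x.
Proof.
move=> mp ip /rootP px; rewrite leNgt; apply/negP => x0.
suff : v p.[x] <= Fin 0 by rewrite px valn0.
elim/poly_ind: p mp ip {px} => [|q c IH] mp ip.
  by move: mp; rewrite monicE lead_coef0 eq_sym oner_eq0.
have ic : Fin 0 <= v c.
  by have := ip 0%N; rewrite coefD coefMX coefC /= add0r.
rewrite !hornerE; have [q0|q0] := eqVneq q 0.
  move: mp; rewrite q0 mul0r add0r monicE lead_coefC => /eqP ->.
  by rewrite horner0 mul0r add0r valn1.
have mq : q \is monic.
  rewrite monicE -(monicP mp) lead_coefDl ?lead_coefMX //.
  by rewrite size_mulX // ltnS (leq_trans (size_polyC_leq1 _)) // size_poly_gt0.
have iq : Defs.integral_poly v q.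
  by move=> i; have := ip i.+1; rewrite coefD coefMX coefC /= addr0.
have := IH mq iq; have [b xb] := extval_lt_fin x0.
case E : (v q.[x]) => [a|//]; rewrite extval_leE => a0.
have qx0 : v (q.[x] * x) < Fin 0.
  move: x0; rewrite valnM E xb /= !extval_ltE => b0.
  by rewrite -[X in _ < X]addr0 addrC oag_ltD.
by rewrite addrC valnD_lt; [exact: ltW | exact: lt_le_trans ic].
Qed.

End IntegralRoots.

Section Main.
Variables (G : oagType) (K L : fieldType) (Lbar : closedFieldType).
Variables (vK : valuation K G) (vL : valuation L G) (vLbar : valuation Lbar G).
Variables (iota : {rmorphism K -> L}) (j : {rmorphism L -> Lbar}) (S : nat -> L).
Hypothesis G_divisible : divisible_group G.
Hypothesis K_residue : infinite_set (residue_field vK).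
Hypothesis iota_val : forall x : K, vL (iota x) = vK x.
Hypothesis L_complete : complete_valued vL.
Hypothesis L_henselian : henselian vL.
Hypothesis j_val : forall x : L, vLbar (j x) = vL x.

Let ji : {rmorphism K -> Lbar} := j \o iota.

Let ji_val (x : K) : vLbar (ji x) = vK x.
Proof. by rewrite /= j_val iota_val. Qed.

Lemma map_poly_in (I : Lbar -> Prop) (p : {poly L}) :
  poly_in (I \o j) p -> poly_in I (map_poly j p).
Proof. by move=> Ip i; rewrite coef_map; exact: Ip. Qed.

Lemma map_integral (p : {poly L}) :
  Defs.integral_poly vL p -> Defs.integral_poly vLbar (map_poly j p).
Proof. by move=> ip i; rewrite coef_map j_val; exact: ip. Qed.

Lemma unit_const_horner (q : {poly L}) (y : Lbar) :
  unit_const_poly vL q -> Fin 0 <= vLbar y -> vLbar (map_poly j q).[y] = Fin 0.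
Proof.
move=> [iq q0 qs] y0.
have small := valn_ideal_gt vLbar 0.
rewrite -[map_poly j q](subrK (j q`_0)%:P) hornerD hornerC valnD_lt j_val q0 //.
apply: (poly_in_horner small) => // i; rewrite coefB coef_map coefC.
case: eqP => [->|/eqP i0]; first by rewrite subrr valn0.
by rewrite subr0 j_val; apply: qs; rewrite lt0n.
Qed.

(** The witness [z] is the monic factor of the truncation evaluated at [y - u]. The other factor is
    a unit there, and the monic factors tend to [P], whose roots, translated back by [u], form
    [cs]. *)
Lemma ps_normalized_zeros (t : nat -> L) n :
  (forall k, Fin 0 <= vL (t k)) -> vL (t n) = Fin 0 ->
  (forall k, (n < k)%N -> Fin 0 < vL (t k)) ->
  (forall g, exists m, forall k, (m <= k)%N -> Fin g < vL (t k)) ->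
  exists2 cs : seq Lbar, (forall c, c \in cs -> Fin 0 <= vLbar c) &
    forall y, Fin 0 <= vLbar y -> forall g, exists m, forall k, (m <= k)%N ->
      exists2 z, vLbar (map_poly j (\poly_(i < k) t i)).[y] = vLbar z &
        Fin g < vLbar (z - \prod_(c <- cs) (y - c)).
Proof.
move=> t_int tn t_small t_lim.
have [us [us_int usP]] : exists us : seq L, (forall u, u \in us -> Fin 0 <= vL u) /\
    forall x, Fin 0 <= vL x -> (forall u, u \in us -> vL (x - u) <= Fin 0) ->
      vL (\poly_(i < n.+1) t i).[x] = Fin 0.
  apply: unit_value_list => [i|]; first by rewrite coef_poly; case: ifP; rewrite ?valn0.
  by exists n; rewrite coef_poly ltnSn.
have [u0 u0_int u0P] := residue_avoid iota_val us K_residue.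
set u := iota u0 in u0P; have u_int : Fin 0 <= vL u by rewrite iota_val.
have [P [mP iP PP]] := henselian_series_factor L_henselian L_complete t_int tn
  t_small t_lim u_int (usP u u_int u0P).
have [rs rsE] := closed_field_poly_normal (map_poly j P).
rewrite lead_coef_map (monicP mP) rmorph1 scale1r in rsE.
have rs_int r : r \in rs -> Fin 0 <= vLbar r.
  move=> rrs; apply: (@monic_root_integral _ _ _ (map_poly j P)).
  - by rewrite map_monic.
  - exact: map_integral.
  - by rewrite rsE root_prod_XsubC.
exists [seq r + j u | r <- rs] => [c /mapP[r rrs ->]|y y0 g].
  case: (valn_ideal_ge vLbar (Fin 0)) => _ D _; apply: D; last by rewrite j_val.
  exact: rs_int.
have [m mE] := PP g; exists m => k /mE [p [q [tE pP qP]]].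
have yu : Fin 0 <= vLbar (y - j u).
  by apply: (valn_idealB (valn_ideal_ge vLbar (Fin 0))); rewrite ?j_val.
exists (map_poly j p).[y - j u].
  have -> : (map_poly j (\poly_(i < k) t i)).[y] =
      (map_poly j p).[y - j u] * (map_poly j q).[y - j u].
    have := congr1 (map_poly j) tE.
    rewrite map_comp_poly rmorphM rmorphD /= map_polyX map_polyC /= -hornerM => <-.
    by rewrite horner_comp !hornerE subrK.
  by rewrite mulrC valnM_unit // unit_const_horner.
have -> : \prod_(c <- [seq r + j u | r <- rs]) (y - c) = (map_poly j P).[y - j u].
  rewrite rsE big_map horner_prod; apply: eq_bigr => r _.
  by rewrite !hornerE; ring.
rewrite -hornerN -hornerD -rmorphB.
apply: (poly_in_horner (valn_ideal_gt vLbar g)) => //; apply: map_poly_in => i /=.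
by rewrite j_val; exact: pP.
Qed.

Lemma ps_sums_map (x : L) n : ps_sums vLbar (j \o S) (j x) n = j (ps_sums vL S x n).
Proof.
rewrite /ps_sums /series /= rmorph_sum; apply: eq_bigr => k _.
by rewrite rmorphM rmorphXn.
Qed.

(** What is needed about [S] on the ball [v(x) >= a]. The roots form a list with repetitions, not a
    set, because multiplicities count in the slopes. *)
Definition root_data (a nu : G) (cs : seq Lbar) :=
  [/\ forall c, c \in cs -> Fin a <= vLbar c,
      forall x, Fin a <= vLbar x -> (zero_set vLbar j S x <-> x \in cs) &
      forall (x : K) b, vK x = Fin b -> a <= b ->
        valS vL iota S x = extval_add (Fin nu)
          (\big[@extval_add G/Fin 0]_(c <- cs) vLbar (ji x - c))].

Lemma ps_root_data n0 a : S n0 != 0 -> ps_null vL S a ->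
  exists nu cs, root_data a nu cs.
Proof.
move=> S0 nullS; have [n [Sn min_n last_n]] := ps_null_last_min S0 nullS.
have [w wa] := valn_onto vL a; have w0 : w != 0 by exact: valn_fin_neq0 wa.
pose s := S n * w ^+ n.
have s0 : s != 0 by rewrite mulf_neq0 // expf_neq0.
have [sg sE] := valn_neq0 vL s0.
pose t k := S k * w ^+ k / s.
have tE k : vL (t k) = extval_add (Fin (- sg)) (extval_add (vL (S k)) (Fin (a *+ k))).
  by rewrite valnM (valnV sE) extval_addC valnM (valnX k wa).
have sgE : extval_add (vL (S n)) (Fin (a *+ n)) = Fin sg.
  by rewrite -sE valnM (valnX n wa).
have z0 : Fin 0 = extval_add (Fin (- sg)) (Fin sg) by rewrite /= addNr.
have [||k nk|g|cs cs_int csP] := @ps_normalized_zeros t n.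
- by move=> k; rewrite tE z0 extval_leD2l -sgE.
- by rewrite tE sgE -z0.
- by rewrite tE z0 extval_ltD2l -sgE; exact: last_n.
- have [m mP] := nullS (sg + g); exists m => k /mP.
  rewrite tE -{2}[g](addKr sg) -[Fin (- sg + _)]/(extval_add (Fin _) (Fin _)).
  by rewrite extval_ltD2l.
have jwa : vLbar (j w) = Fin a by rewrite j_val.
have jw0 : j w != 0 by exact: valn_fin_neq0 jwa.
have jsE : vLbar (j s) = Fin sg by rewrite j_val.
(* Undoes the rescaling: the product of the [x / w - c], times [s], is [b] times the product of the
   [x - w c]. *)
pose b := j s / j w ^+ size cs.
have bE : vLbar b = Fin (sg - a *+ size cs).
  by rewrite valnM jsE (valnV (valnX _ jwa)).
have b0 : b != 0 by exact: valn_fin_neq0 bE.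
pose cs' := [seq j w * c | c <- cs].
have limP x : Fin a <= vLbar x -> forall g, exists m, forall k, (m <= k)%N ->
    exists2 z, vLbar (ps_sums vLbar (j \o S) x k) = vLbar z &
      Fin g < vLbar (z - b * \prod_(c <- cs') (x - c)).
  move=> ax g; have y0 : Fin 0 <= vLbar (x / j w).
    rewrite valnM (valnV jwa) extval_addC.
    by rewrite (_ : Fin 0 = extval_add (Fin (- a)) (Fin a)) ?extval_leD2l //= addNr.
  have [m mP] := csP _ y0 (- sg + g); exists m => k /mP[z zE zg].
  exists (j s * z).
    rewrite valnM -zE -valnM; congr (vLbar _).
    rewrite ps_sums_horner horner_poly poly_def rmorph_sum /= horner_sum mulr_sumr.
    apply: eq_bigr => i _.
    have tj : j (t i) = j (S i) * j w ^+ i / j s by rewrite /t 2!rmorphM fmorphV rmorphXn.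
    rewrite map_polyZ map_polyXn !hornerE tj expr_div_n /=; have := expf_neq0 i jw0.
    have : j s != 0 by rewrite fmorph_eq0.
    by move=> js0 jwi0; field; apply/andP.
  have -> : b * \prod_(c <- cs') (x - c) = j s * \prod_(c <- cs) (x / j w - c).
    rewrite /cs' big_map (eq_bigr (fun c => j w * (x / j w - c))); last first.
      by move=> c _; rewrite mulrBr [j w * (x / _)]mulrC divfK.
    by rewrite big_split /= big_const_seq count_predT iter_mulr_1 mulrA divfK ?expf_neq0.
  rewrite -mulrBr valnM jsE -{1}[g](addNKr sg).
  rewrite -[Fin (sg + _)]/(extval_add (Fin _) (Fin _)).
  by rewrite extval_ltD2l.
exists (sg - a *+ size cs), cs'; split.
- move=> c /mapP[d dcs ->]; rewrite valnM jwa.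
  apply: (@le_trans _ _ (extval_add (Fin a) (Fin 0))); first by rewrite /= addr0.
  by rewrite extval_leD2l cs_int.
- move=> x ax.
  have prod0 : (b * \prod_(c <- cs') (x - c) == 0) = (x \in cs').
    rewrite mulf_eq0 (negPf b0) prodf_seq_eq0 /= -has_pred1.
    by apply: eq_has => c /=; rewrite subr_eq0 eq_sym.
  split=> [/ps_zerosP xZ|xcs].
    rewrite -prod0; apply/eqP/(valn_eqInfty vLbar); rewrite -(valn0 vLbar).
    apply/esym; apply: (valued_cvg_valn_eq _ (limP x ax)) => g.
    by have [m mP] := xZ g; exists m => k; rewrite subr0; exact: mP.
  apply/ps_zerosP => g; have [m mP] := limP x ax g; exists m => k /mP[z ->].
  by move: xcs; rewrite -prod0 => /eqP ->; rewrite subr0.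
- move=> x d xd ad.
  have ixd : vL (iota x) = Fin d by rewrite iota_val.
  have cvgx := ps_null_cvg L_complete ixd (ps_null_le ad nullS).
  rewrite /valS -j_val -bE -valn_prod -valnM.
  have ax : Fin a <= vLbar (ji x) by rewrite ji_val xd extval_leE.
  apply: (valued_cvg_valn_eq _ (limP _ ax)) => g.
  have [m mP] := ps_cvg_limP cvgx g; exists m => k /mP.
  by rewrite [ji x]/= ps_sums_map -rmorphB j_val.
Qed.

(** Convergence depends on the value alone: one point of a sphere decides for all of them. *)
Lemma conv_valuesP a : conv_values vK vL iota S a <-> ps_null vL S a.
Proof.
split=> [[x xD xa]|nullS]; first by apply: ps_cvg_null xD _; rewrite iota_val.
have [x xa] := valn_onto vK a; exists x => //.
by apply: (ps_null_cvg L_complete _ nullS); rewrite iota_val.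
Qed.

Lemma valS0 x : (forall n, S n = 0) -> valS vL iota S x = Infty.
Proof.
move=> S0; apply/valn_eqInfty.
have /ps_zerosP[] // : forall g : G, exists m, forall n, (m <= n)%N ->
  Fin g < vL (ps_sums vL S (iota x) n).
move=> g; exists 0%N => n _; rewrite ps_sums_horner.
rewrite (_ : \poly_(i < n) S i = 0) ?horner0 ?valn0 ?extval_lt_Infty //.
by apply/polyP => i; rewrite coef_poly coef0 S0 if_same.
Qed.

Lemma zero_set0 x : (forall n, S n = 0) -> zero_set vLbar j S x.
Proof.
move=> S0; apply/ps_zerosP => g; exists 0%N => n _; rewrite ps_sums_horner.
rewrite (_ : \poly_(i < n) (j \o S) i = 0) ?horner0 ?valn0 ?extval_lt_Infty //.
by apply/polyP => i; rewrite coef_poly coef0 /= S0 rmorph0 if_same.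
Qed.

(** * Values on spheres, read off the roots *)

Section RootData.
Variables (a nu : G) (cs : seq Lbar).
Hypothesis data : root_data a nu cs.

Definition least_value (b : G) : G := nu + \sum_(c <- cs) trunc b (vLbar c).

Lemma least_value_mono g h : g <= h -> least_value g <= least_value h.
Proof.
by move=> gh; rewrite oag_leD2lE; apply: oag_le_sum => c; exact: trunc_le_mono.
Qed.

Lemma least_value_lip g h :
  g <= h -> least_value h <= least_value g + (h - g) *+ size cs.
Proof.
move=> gh; rewrite -addrA oag_leD2lE -(sum_const_seq cs) -big_split /=.
by apply: oag_le_sum => c; exact: trunc_le_lip.
Qed.

(** The lower bound is the ultrametric inequality for each root; a generic shift of [0] by an
    element of value [b] makes all of these equalities simultaneously. *)
Lemma is_least_value b : a <= b ->
  is_least (valS vL iota S @` sphere vK b) (Fin (least_value b)).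
Proof.
move=> ab; have [cs_int _ valE] := data; split.
  have [t tb tP] := generic_shift ji_val 0 b cs K_residue.
  exists t => //; rewrite (valE _ _ tb ab) /least_value.
  rewrite -[Fin (_ + _)]/(extval_add (Fin _) (Fin _)) -extval_sum_fin.
  congr extval_add; apply: eq_big_seq => c ccs.
  by have := tP c ccs; rewrite add0r rmorph0 sub0r valnN truncE.
move=> _ [x xb <-]; rewrite (valE _ _ xb ab) /least_value.
rewrite -[Fin (_ + _)]/(extval_add (Fin _) (Fin _)) -extval_sum_fin extval_leD2l.
apply: extval_le_sum => c ccs; rewrite truncE.
by apply: le_trans (valnD _ _ _); rewrite valnN ji_val xb.
Qed.

(** With no root of value [b], no cancellation in [x - c] is possible, so every point of the sphere
    behaves like a generic one. *)
Lemma valS_off_zeros b x : a <= b -> ~ zero_values vLbar j S b -> vK x = Fin b ->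
  valS vL iota S x = Fin (least_value b).
Proof.
move=> ab bH xb; have [cs_int csZ valE] := data.
rewrite (valE _ _ xb ab) /least_value.
rewrite -[Fin (_ + _)]/(extval_add (Fin _) (Fin _)) -extval_sum_fin.
congr extval_add; apply: eq_big_seq => c ccs; rewrite truncE.
case: (ltgtP (Fin b) (vLbar c)) => bc.
- by rewrite addrC valnD_lt ?ji_val ?valnN ?xb.
- by rewrite valnD_lt ?ji_val ?valnN ?xb.
by case: bH; exists c; rewrite ?bc //; apply/csZ => //; exact: cs_int.
Qed.

(* The value at a generic point of the ball of radius [l] around [y] is
   [nu + \sum trunc l (v (y - c))]; [l] moves it from the minimum to [v (S y)]. *)
Lemma valS_ivt x y g : vK x = Fin a -> vK y = Fin a ->
  valS vL iota S x <= Fin g -> Fin g <= valS vL iota S y ->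
  exists2 z, vK z = Fin a & valS vL iota S z = Fin g.
Proof.
move=> xa ya xg gy; have [cs_int csZ valE] := data.
have dist_ge z c : vK z = Fin a -> c \in cs -> Fin a <= vLbar (ji z - c).
  move=> za ccs; apply: le_trans (valnD _ _ _); rewrite le_min valnN ji_val za.
  by rewrite lexx cs_int.
pose es := [seq vLbar (ji y - c) | c <- cs].
have [||| l al sum_l] := @trunc_sum_ivt _ es a (- nu + g) G_divisible.
- by move=> e /mapP[c ccs ->]; exact: dist_ge.
- rewrite size_map -(oag_leD2lE nu) addNKr -extval_leE.
  apply: le_trans xg; rewrite (valE _ _ xa (lexx a)).
  rewrite -[Fin (_ + _)]/(extval_add (Fin _) (Fin _)) extval_leD2l.
  rewrite -(sum_const_seq cs) -extval_sum_fin.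
  by apply: extval_le_sum => c; exact: dist_ge.
- by rewrite big_map -(extval_leD2l nu) -(valE _ _ ya (lexx a)) /= addNKr.
(* The added entry [0] keeps [y + t] on the sphere: its value is [min(l, a)], and [a <= l]. *)
have [t tl tP] := generic_shift ji_val y l (0 :: cs) K_residue.
have za : vK (y + t) = Fin a.
  have := tP 0; rewrite inE eqxx => /(_ isT); rewrite !subr0 !ji_val ya => ->.
  by rewrite min_r // extval_leE.
exists (y + t) => //; rewrite (valE _ _ za (lexx a)).
rewrite (eq_big_seq (fun c => Fin (trunc l (vLbar (ji y - c))))).
  rewrite extval_sum_fin /= -(big_map (fun c => vLbar (ji y - c)) xpredT (trunc l)).
  by rewrite sum_l addNKr.
by move=> c ccs; rewrite truncE; apply: tP; rewrite inE ccs orbT.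
Qed.

End RootData.

Lemma series_cases : (exists n, S n != 0) \/ (forall n, S n = 0).
Proof.
have [|S0] := pselect (exists n, S n != 0); [by left | right=> n].
by apply/eqP/negPn/negP => Sn; apply: S0; exists n.
Qed.

Lemma conv_values_root_data a : (exists n, S n != 0) ->
  conv_values vK vL iota S a -> exists nu cs, root_data a nu cs.
Proof. by move=> [n Sn] /conv_valuesP; exact: ps_root_data Sn. Qed.

Lemma sphere_ivt a x y g : conv_values vK vL iota S a ->
  vK x = Fin a -> vK y = Fin a ->
  valS vL iota S x <= Fin g -> Fin g <= valS vL iota S y ->
  exists2 z, vK z = Fin a & valS vL iota S z = Fin g.
Proof.
move=> aD xa ya xg gy; have [Sn|S0] := series_cases.
  have [nu [cs data]] := conv_values_root_data Sn aD.
  exact: (valS_ivt data xa ya xg gy).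
by move: xg; rewrite valS0.
Qed.

Lemma sphere_zero a x y : conv_values vK vL iota S a ->
  vK x = Fin a -> vK y = Fin a -> valS vL iota S x != valS vL iota S y ->
  zero_values vLbar j S a.
Proof.
move=> aD xa ya xy; apply: contrapT => aH; move/eqP: xy; apply.
have [Sn|S0] := series_cases; last by rewrite !valS0.
have [nu [cs data]] := conv_values_root_data Sn aD.
by rewrite !(valS_off_zeros data (lexx a) aH).
Qed.

Lemma zero_values_null a : zero_values vLbar j S a -> ps_null vL S a.
Proof.
move=> [x [xD _] xa] h; have [m mP] := ps_cvg_null xD xa h.
by exists m => n /mP; rewrite /= j_val.
Qed.

Lemma zero_set_finite a : (exists n, S n != 0) -> zero_values vLbar j S a ->
  finite_set [set x | zero_set vLbar j S x /\ Fin a <= vLbar x].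
Proof.
move=> [n Sn] /zero_values_null nullS.
have [nu [cs [_ csZ _]]] := ps_root_data Sn nullS.
apply: (@sub_finite_set _ _ [set` cs]); last exact: finite_seq.
by move=> x [xZ ax]; apply/csZ.
Qed.

Lemma zero_values_finite a : (exists n, S n != 0) -> zero_values vLbar j S a ->
  finite_set [set b | zero_values vLbar j S b /\ a < b].
Proof.
move=> Sn /(zero_set_finite Sn) finZ.
(* The default [0] is taken only at [x = 0]; a spurious element in the finite image does no harm. *)
pose value x := if vLbar x is Fin g then g else 0.
apply: sub_finite_set (finite_image value finZ) => b [[x xZ xb] ab].
by exists x; rewrite /value ?xb //=; split=> //; rewrite xb extval_leE ltW.
Qed.

Lemma exists_least a : conv_values vK vL iota S a ->
  exists m, is_least (valS vL iota S @` sphere vK a) m.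
Proof.
move=> aD; have [Sn|S0] := series_cases.
  have [nu [cs data]] := conv_values_root_data Sn aD.
  by eexists; exact: (is_least_value data (lexx a)).
have [x xa] := valn_onto vK a; exists Infty; split.
  by exists x; rewrite ?valS0.
by move=> _ [y _ <-]; rewrite valS0.
Qed.

Lemma sphere_interval a : conv_values vK vL iota S a ->
  left_closed_interval (valS vL iota S @` sphere vK a).
Proof.
move=> aD; have [x xa] := valn_onto vK a; split; last exact: exists_least.
  by exists (valS vL iota S x), x.
move=> _ _ z [y ya <-] [y' y'a <-] /andP[yz zy'].
case: z yz zy' => [g|] yz zy'; last first.
  by exists y' => //; apply/le_anti; rewrite zy' extval_leInfty.
by have [w wa wg] := sphere_ivt aD ya y'a yz zy'; exists w.
Qed.

(** * The map of least values: slopes and continuity *)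

Section LeastValueMap.
Variable phi : G -> extval G.
Hypothesis phi_least : forall a, conv_values vK vL iota S a ->
  is_least (valS vL iota S @` sphere vK a) (phi a).

Lemma phi_root_data a nu cs b : root_data a nu cs -> a <= b ->
  conv_values vK vL iota S b -> phi b = Fin (least_value nu cs b).
Proof.
move=> data ab bD; have [phi_in phi_lb] := phi_least bD.
have [val_in val_lb] := is_least_value data ab.
by apply/le_anti; rewrite phi_lb // val_lb.
Qed.

Lemma phi_is_phi : is_phi vK vL vLbar iota j S phi.
Proof.
move=> a x [aD aH] xD xa; have [Sn|S0] := series_cases.
  have [nu [cs data]] := conv_values_root_data Sn aD.
  by rewrite (phi_root_data data (lexx a) aD) (valS_off_zeros data (lexx a) aH xa).
by have [[y _ <-] _] := phi_least aD; rewrite !valS0.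
Qed.

Lemma phi_mono a b : conv_values vK vL iota S a -> conv_values vK vL iota S b ->
  a <= b -> phi a <= phi b.
Proof.
move=> aD bD ab; have [Sn|S0] := series_cases.
  have [nu [cs data]] := conv_values_root_data Sn aD.
  rewrite (phi_root_data data (lexx a) aD) (phi_root_data data ab bD).
  by rewrite extval_leE least_value_mono.
by have [[y _ <-] _] := phi_least bD; rewrite (valS0 _ S0) extval_leInfty.
Qed.

(** A root with value in [[g, h)] would, by convexity, put a zero value into [C]. So all roots of
    the ball at [g] have value at least [h], each contributes [h], and the slope is their number. *)
Lemma phi_linear_from (C : set G) g : (exists n, S n != 0) -> convex_in C ->
  C `<=` conv_values vK vL iota S -> C `&` zero_values vLbar j S = set0 -> C g ->
  exists A B, forall h, C h -> g <= h -> phi h = Fin (A + h *+ B).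
Proof.
move=> Sn convC CD CH Cg; have [nu [cs data]] := conv_values_root_data Sn (CD _ Cg).
have [cs_int csZ _] := data.
exists nu, (size cs) => h Ch gh; rewrite (phi_root_data data gh (CD _ Ch)).
congr (Fin (nu + _)); rewrite -(sum_const_seq cs); apply: eq_big_seq => c ccs.
apply: trunc_id; rewrite leNgt; apply/negP => ch.
have [k ck] := extval_lt_fin ch; rewrite ck extval_ltE in ch.
have gk : g <= k by rewrite -extval_leE -ck; exact: cs_int.
have : (C `&` zero_values vLbar j S) k.
  split; first by apply: convC Cg Ch _; rewrite gk ltW.
  by exists c => //; apply/csZ => //; exact: cs_int.
by rewrite CH.
Qed.

(** The constants of [phi_linear_from] depend on the starting point, and [C] may lack a least
    element. Two points [g1 < g2] determine them, since multiples of [g2 - g1 > 0] are distinct;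
    hence an earlier starting point gives the same constants. *)
Lemma phi_stepwise_linear : stepwise_linear vK vL vLbar iota j S phi.
Proof.
move=> C convC CD CH; have [Sn|S0] := series_cases; last first.
  (* For the zero series every value is a zero value, so [C] is empty. *)
  exists 0, 0%N => g Cg; have : (C `&` zero_values vLbar j S) g.
    split=> //; have [x xg] := valn_onto vLbar g.
    by exists x => //; exact: zero_set0.
  by rewrite CH.
have linear_from := phi_linear_from Sn convC CD CH.
have [[g1 [g2 [C1 C2 g12]]]|one] :=
    pselect (exists g1 g2, [/\ C g1, C g2 & g1 < g2]); last first.
  have [[g Cg]|C0] := pselect (exists g, C g); last first.
    by exists 0, 0%N => g Cg; case: C0; exists g.
  have [A [B AB]] := linear_from g Cg; exists A, B => h Ch; apply: AB => //.
  by rewrite leNgt; apply/negP => hg; apply: one; exists h, g.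
have [A [B AB]] := linear_from g1 C1; exists A, B => h Ch.
have [g1h|hg1] := leP g1 h; first exact: AB.
have [A' [B' AB']] := linear_from h Ch.
have eq1 : A + g1 *+ B = A' + g1 *+ B'.
  by have := AB' _ C1 (ltW hg1); rewrite (AB _ C1) // => -[].
have eq2 : A + g2 *+ B = A' + g2 *+ B'.
  by have := AB' _ C2 (ltW (lt_trans hg1 g12)); rewrite (AB _ C2 (ltW g12)) => -[].
have BB : B = B'.
  apply: (@oag_mulrn_inj _ _ _ (g2 - g1)); first by rewrite oag_subr_gt0.
  have cancelA (x y z : G) : x - y = (z + x) - (z + y).
    by rewrite opprD addrACA subrr add0r.
  by rewrite !mulrnBl (cancelA (g2 *+ B) _ A) eq1 eq2 -cancelA.
rewrite AB' //; congr (Fin (_ + _)); last by rewrite BB.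
by move: eq1; rewrite BB => /addIr.
Qed.

Lemma phi_continuous : (exists g : G, g != 0) ->
  {within (conv_values vK vL iota S : set (order_topology G)),
    continuous (phi : order_topology G -> order_topology (extval G))}.
Proof.
move=> nontriv; apply/subspace_continuousP => a aD.
have [Sn|S0] := series_cases; last first.
  have phiS0 x : conv_values vK vL iota S x -> phi x = Infty.
    by move=> /phi_least[[y _ <-] _]; exact: valS0.
  move=> B /nbhs_singleton Ba.
  suff : nbhs (a : order_topology G) [set x | conv_values vK vL iota S x -> B (phi x)].
    by [].
  by apply: filterE => x xD; rewrite phiS0 // -(phiS0 _ aD).
have near_data (U : set (order_topology G)) b nu cs : root_data b nu cs ->
    nbhs (a : order_topology G) U ->
    (forall x, conv_values vK vL iota S x -> U x -> b <= x) ->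
    (phi : order_topology G -> order_topology (extval G)) @
      within (conv_values vK vL iota S) (nbhs (a : order_topology G)) -->
      (phi a : order_topology (extval G)).
  move=> data aU Ub.
  apply: (@lipschitz_within_cvg _ _ U _ (least_value nu cs) _ (size cs)) => //.
    by move=> x xD /(Ub x xD) bx; exact: phi_root_data data bx xD.
  move=> x y _ _ _ _ xy; split; first exact: least_value_mono.
  exact: least_value_lip.
(* Root data at some [b < a] describe [phi] on both sides of [a]. If there is no such [b], the
   domain starts at [a] and the data at [a] suffice. *)
have [[b bD ba]|min_a] := pselect (exists2 b, conv_values vK vL iota S b & b < a).
  have [nu [cs data]] := conv_values_root_data Sn bD.
  apply: (near_data `]b, +oo[%classic _ _ _ data) => [|x _].
    by apply: open_nbhs_nbhs; split; [exact: rray_open | rewrite /= in_itv /= ba].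
  by rewrite /= in_itv /= andbT => /ltW.
have [nu [cs data]] := conv_values_root_data Sn aD.
apply: (near_data setT _ _ _ data) => [|x xD _]; first exact: filterT.
by rewrite leNgt; apply/negP => xa; apply: min_a; exists x.
Qed.

End LeastValueMap.

Lemma exists_least_map : exists phi : G -> extval G,
  forall a, conv_values vK vL iota S a ->
    is_least (valS vL iota S @` sphere vK a) (phi a).
Proof.
have /choice[phi phiP] a : exists m, conv_values vK vL iota S a ->
    is_least (valS vL iota S @` sphere vK a) m.
  have [/exists_least[m mP]|aD] := pselect (conv_values vK vL iota S a).
    by exists m.
  by exists Infty => /aD.
by exists phi.
Qed.

End Main.

Theorem theorem4p6
    (G : oagType) (K L : fieldType) (Lbar : closedFieldType)
    (vK : valuation K G) (vL : valuation L G) (vLbar : valuation Lbar G)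
    (iota : {rmorphism K -> L}) (j : {rmorphism L -> Lbar}) (S : nat -> L)
    (G_nontrivial : exists g : G, g != 0)
    (G_divisible : divisible_group G)
    (K_residue : infinite_set (residue_field vK))
    (K_basis : countable_nbhs_basis0 vK)
    (iota_val : forall x : K, vL (iota x) = vK x)
    (L_complete : complete_valued vL)
    (L_henselian : henselian vL)
    (L_basis : countable_nbhs_basis0 vL)
    (Lbar_algebraic : forall x : Lbar, algebraicOver j x)
    (j_val : forall x : L, vLbar (j x) = vL x) :
  let C := sphere vK in
  let D := conv_dom vL iota S in
  let vD := conv_values vK vL iota S in
  let Z := zero_set vLbar j S in
  let HS := zero_values vLbar j S in
  let vS := valS vL iota S in
  [/\ forall alpha : G, C alpha `<=` D ->
      forall a b : K, C alpha a -> C alpha b -> vS a != vS b ->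
        (exists2 c : Lbar, vLbar c = Fin alpha & Z c) /\
        (forall gamma : G,
           Order.min (vS a) (vS b) <= Fin gamma <= Order.max (vS a) (vS b) ->
           exists2 c' : K, C alpha c' & vS c' = Fin gamma),
      (exists n : nat, S n != 0) ->
      forall alpha : G, HS alpha ->
        finite_set [set x | Z x /\ Fin alpha <= vLbar x] /\
        finite_set [set beta | HS beta /\ alpha < beta],
      exists phi : G -> extval G,
        [/\ is_phi vK vL vLbar iota j S phi,
            stepwise_linear vK vL vLbar iota j S phi &
            forall x y : G, (vD `\` HS) x -> (vD `\` HS) y ->
              x <= y -> phi x <= phi y],
      forall alpha : G, vD alpha ->
        left_closed_interval (vS @` C alpha)
    & exists phi : G -> extval G,
        [/\ is_phi vK vL vLbar iota j S phi,
            forall alpha : G, vD alpha ->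
              is_least (vS @` C alpha) (phi alpha) &
            {within (vD : set (order_topology G)),
              continuous (phi : order_topology G -> order_topology (extval G))}]].
Proof.
move=> C D vD Z HS vS.
(* The map of least values serves for both (c) and (e). *)
have [phi phi_least] : exists phi : G -> extval G,
  forall a, vD a -> is_least (vS @` C a) (phi a) by apply: exists_least_map; eauto.
have phi_ok : is_phi vK vL vLbar iota j S phi by apply: phi_is_phi; eauto.
split.
- move=> alpha CD a b aC bC ab.
  have alphaD : vD alpha by exists a => //; exact: CD.
  have [c cZ c_alpha] : HS alpha by apply: sphere_zero ab; eauto.
  split=> [|gamma]; first by exists c.
  by have [_|_] := leP (vS a) (vS b) => /andP[ga gb]; apply: sphere_ivt ga gb; eauto.
- move=> Sn alpha alphaH.
  by split; [apply: zero_set_finite; eauto | apply: zero_values_finite; eauto].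
- exists phi; split=> //; first by apply: phi_stepwise_linear; eauto.
  by move=> x y [xD _] [yD _]; apply: phi_mono; eauto.
- by move=> alpha alphaD; apply: sphere_interval; eauto.
- by exists phi; split=> //; apply: phi_continuous; eauto.
Qed.
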